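(* Let $C=\sum_{j=1}^M b_jC_j$ where each $C_j$ is Hermitian and unitary and has a corresponding weight vector $w_j$, with $b_j\ge 0$ for all $j$ and $\sum_j b_j=1$. The number of queries to $\mathcal{C}$, $B$ and $\mathcal{T}$ needed to project an unknown state $|\psi\rangle$ onto an eigenvector of $C$ with probability at least $1-\delta$ and to estimate the eigenvalue within error $\epsilon$ is in $$O\left(\frac{1}{\delta\epsilon}\,\frac{\log(1/\epsilon)}{\log\log(1/\epsilon)}\right).$$
   Context: The black boxes are: a unitary $\mathcal{C}$ with $\mathcal{C}|w\rangle|\psi\rangle=|w\rangle C(w)|\psi\rangle$ for any state $|\psi\rangle$, where $|w\rangle\in\mathbb{C}^{2^{n_w}}$ represents the weights specifying the classifier $C(w)$, and $C_j=C(w_j)$; a unitary $\mathcal{T}$ which, up to local isometries, performs $\mathcal{T}|j\rangle|0\rangle=|j\rangle|w_j\rangle$; and a unitary $B$ with $B|0\rangle=\sum_j\sqrt{b_j}|j\rangle$.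
   Formalization: ''Project onto an eigenvector'' is proved at the resolution of the estimate: jointly, the system passes the test for the projection of ψ on an eigenspace and the estimate is within ε of its eigenvalue; eigenvalues within 2ε need not be told apart (exact collapse is impossible gap-independently). *)

(* Defs.v *)
(* MathComp world: matrices over R[i] for R : realType, Kronecker products from
   real_closed.mxtens, adjoints and unitarity from algebra.spectral. *)
From mathcomp Require Import all_boot all_order all_algebra.
From mathcomp Require Import reals sequences exp.
From mathcomp.real_closed Require Import complex mxtens.

Set Implicit Arguments.
Unset Strict Implicit.
Unset Printing Implicit Defensive.

Import Order.TTheory GRing.Theory Num.Theory.
Local Open Scope ring_scope.
Local Open Scope complex_scope.
Local Open Scope sesquilinear_scope.

(* States are column vectors, operators act by left multiplication. *)
Section Kets.
Variable R : realType.
Local Notation C := R[i].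

Definition ket (n : nat) (i : 'I_n) : 'cV[C]_n := delta_mx i 0.

(* The first basis vector; stated without an element of 'I_n so that it is
   available for any dimension (it is 0 only when n = 0). *)
Definition ket0 (n : nat) : 'cV[C]_n := \col_i ((i : nat) == 0)%:R.

(* Relies on 1 * 1 being convertible to 1. *)
Definition tensv (m n : nat) (u : 'cV[C]_m) (v : 'cV[C]_n) : 'cV[C]_(m * n) :=
  u *t v.

Definition unit_state (n : nat) (psi : 'cV[C]_n) : Prop :=
  psi^t* *m psi = 1%:M.

Definition isometry_mx (m n : nat) (V : 'M[C]_(m, n)) : Prop :=
  V^t* *m V = 1%:M.

Definition expval (n : nat) (E : 'M[C]_n) (phi : 'cV[C]_n) : C :=
  (phi^t* *m E *m phi) 0 0.

End Kets.

Section Eigen.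
Variables (R : realType) (n : nat).
Local Notation C := R[i].

(* The distinct eigenvalues of a Hermitian (more generally, normal) matrix. *)
Definition eigvals (A : 'M[C]_n) : seq C :=
  undup [seq spectral_diag A 0 i | i : 'I_n].

(* The orthogonal projection of the column vector psi onto the eigenspace
   {v | A v = l v}; the transpositions are there because [eigenspace] and
   [proj_ortho] deal with row vectors. *)
Definition eigproj (A : 'M[C]_n) (l : C) (psi : 'cV[C]_n) : 'cV[C]_n :=
  (psi^T *m proj_ortho (eigenspace A^T l))^T.

(* |v><v| / <v|v>; this is 0 when v = 0. *)
Definition rank1proj (v : 'cV[C]_n) : 'M[C]_n :=
  ((v^t* *m v) 0 0)^-1 *: (v *m v^t*).

End Eigen.

Section QueryModel.
Variables (R : realType).
Local Notation C := R[i].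

(* The registers of a query algorithm are, in this order,
   - a control qubit,
   - the index register, of dimension dI, on which B acts,
   - the weight register, of dimension 2 ^ nw, and the system register, of
     dimension N, on which the classifier oracle acts,
   - the two registers, of dimensions tJ and tW, on which T acts,
   - a work register of arbitrary dimension a.
   As arbitrary unitaries on the whole space are free, the states can be moved
   at will between registers in between queries. *)
Definition regdim (dI nw N tJ tW a : nat) : nat :=
  (2 * (dI * ((2 ^ nw * N) * ((tJ * tW) * a))))%N.

Variant oracle := OracleC | OracleB | OracleT.

(* [Query o inv] is one (controlled) use of the oracle o, or of its inverse
   when inv is true. *)
Variant gate (D : nat) :=
  | Free of 'M[C]_D
  | Query of oracle & bool.

Definition circuit (D : nat) := seq (gate D).

Definition valid (D : nat) (c : circuit D) : bool :=
  all (fun g => if g is Free U then U \is unitarymx else true) c.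

Definition nqueries (D : nat) (c : circuit D) : nat :=
  count (fun g => if g is Query _ _ then true else false) c.

Variables dI nw N tJ tW a : nat.
Local Notation D := (regdim dI nw N tJ tW a).
Variables (UC : 'M[C]_(2 ^ nw * N)) (UB : 'M[C]_dI) (UT : 'M[C]_(tJ * tW)).

Definition controlled (n : nat) (A : 'M[C]_n) : 'M[C]_(2 * n) :=
  delta_mx 0 0 *t 1%:M + delta_mx ord_max ord_max *t A.

(* The inverse of a unitary is its adjoint. *)
Definition adj_if (inv : bool) (n : nat) (A : 'M[C]_n) : 'M[C]_n :=
  if inv then A^t* else A.

Definition query_mx (o : oracle) (inv : bool) : 'M[C]_D :=
  controlled
    match o with
    | OracleB => adj_if inv UB *t 1%:M
    | OracleC => 1%:M *t (adj_if inv UC *t 1%:M)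
    | OracleT => 1%:M *t (1%:M *t (adj_if inv UT *t 1%:M))
    end.

Definition gate_mx (g : gate D) : 'M[C]_D :=
  match g with Free U => U | Query o inv => query_mx o inv end.

(* Head of the list first; psi is loaded in the system register, and the other
   registers start in their |0>. *)
Definition final_state (c : circuit D) (psi : 'cV[C]_N) : 'cV[C]_D :=
  foldl (fun phi g => gate_mx g *m phi)
    (tensv (ket0 R 2) (tensv (ket0 R dI)
      (tensv (tensv (ket0 R (2 ^ nw)) psi)
        (tensv (tensv (ket0 R tJ) (ket0 R tW)) (ket0 R a))))) c.

(* At the end the work register is measured in its standard basis, outcome y
   giving the estimate [est y]. For an eigenvalue l of A, the effect below is
   "the estimate is within eps of l and the system passes the test for being
   in the state obtained by projecting psi onto the l-eigenspace of A". *)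
Definition good_effect (A : 'M[C]_N) (est : 'I_a -> R) (eps : R)
    (psi : 'cV[C]_N) (l : C) : 'M[C]_D :=
  1%:M *t (1%:M *t ((1%:M *t rank1proj (eigproj A l psi)) *t
    (1%:M *t diag_mx (\row_y (`|l - (est y)%:C| <= eps%:C)%R%:R)))).

(* The events summed here are mutually exclusive, and this is the probability
   that the output is an eigenvector to which A projects psi, together with an
   estimate of its eigenvalue within eps. As is unavoidable with a number of
   queries that does not depend on the gaps in the spectrum of A, eigenvalues
   closer than the resolution eps need not be told apart by the estimate; when
   they are more than 2 * eps apart, each outcome y is compatible with at most
   one of them, and the sum is the expected fidelity of the state
   left by outcome y with the corresponding normalized projection of psi. *)
Definition success_prob (c : circuit D) (A : 'M[C]_N) (est : 'I_a -> R)
    (eps : R) (psi : 'cV[C]_N) : C :=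
  \sum_(l <- eigvals A)
    expval (good_effect A est eps psi l) (final_state c psi).

End QueryModel.

(* Main.v *)
(** Write A = sum_j b_j C_j. An ancilla of dimension 3 turns the queries into a
    unitary S and an isometry G : psi |-> g with G^* S G = mu, where
    mu = 1/sqrt 2 + kappa A and kappa = sqrt delta / 8; moreover S exchanges g
    and s := S g. For an eigenvector psi of A everything takes place in the
    plane spanned by g and s. There W = (1 - 2 G G^* ) S has the eigenvectors
    g - z s, where z = mu + i nu and mu^2 + nu^2 = 1, and the eigenvalues
    - 1/z.

    Leaving the eigenvector psi behind, unentangled, is the difficulty: phase
    estimation of W on g would entangle the two eigenvectors of W with the two
    signs of the phase. Since mu is within kappa of 1/sqrt 2, the vector s,
    after its component along g has been multiplied by i, has overlap
    1 - O(kappa^2) = 1 - O(delta) with a single eigenvector of W. So one rotates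
    g to that vector, estimates the phase, and rotates back.

    The phase is estimated by applying W^k to a window sum_k a_k |k>, with a_k
    proportional to k (n - k), and measuring in an eigenbasis of the cyclic
    shift Omega. If v_k = a_k zeta^k then (zeta - Omega) v has squared norm
    sum_k (a_k - a_(k+1))^2 = O(1/n^2), which bounds the mean square error of
    the measured eigenvalue; by Chebyshev the estimate of mu is off by more than
    kappa eps with probability O(1/(n kappa eps)^2), which is at most delta/2
    for some n = O(1/(delta eps)). As log (1/eps) / log (log (1/eps)) >= 1, the
    5 n + 5 queries used are within the bound. *)

Require Import Defs.
From mathcomp Require Import all_boot all_order all_algebra all_fingroup.
From mathcomp Require Import reals sequences exp.
From mathcomp.real_closed Require Import complex mxtens.
From mathcomp Require Import ring lra zify.

Set Implicit Arguments.
Unset Strict Implicit.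
Unset Printing Implicit Defensive.

Import Order.TTheory GRing.Theory Num.Theory.
Local Open Scope ring_scope.
Local Open Scope sesquilinear_scope.

(** * Orthonormal families and the gates built from them *)

Fact swap_key : unit.
Proof. exact: tt. Qed.

Fact phase_key : unit.
Proof. exact: tt. Qed.

Section InnerProduct.
Variable C : numClosedFieldType.

Definition cdot (n : nat) (u v : 'cV[C]_n) : C := (u^t* *m v) 0 0.

Lemma cdotE n (u v : 'cV[C]_n) : cdot u v = \sum_i (u i 0)^* * v i 0.
Proof. by rewrite /cdot mxE; apply: eq_bigr => i _; rewrite !mxE. Qed.

Lemma mul_adj_cdot n (u v : 'cV[C]_n) : u^t* *m v = (cdot u v)%:M.
Proof. by rewrite [LHS]mx11_scalar. Qed.

Lemma cdotC n (u v : 'cV[C]_n) : cdot u v = (cdot v u)^*.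
Proof.
rewrite !cdotE rmorph_sum; apply: eq_bigr => i _.
by rewrite rmorphM /= conjCK mulrC.
Qed.

Lemma cdotD n (u v w : 'cV[C]_n) : cdot u (v + w) = cdot u v + cdot u w.
Proof. by rewrite /cdot mulmxDr mxE. Qed.

Lemma cdotZ n (u v : 'cV[C]_n) a : cdot u (a *: v) = a * cdot u v.
Proof. by rewrite /cdot -scalemxAr mxE. Qed.

Lemma cdot0 n (u : 'cV[C]_n) : cdot u 0 = 0.
Proof. by rewrite /cdot mulmx0 mxE. Qed.

Lemma cdotN n (u v : 'cV[C]_n) : cdot u (- v) = - cdot u v.
Proof. by rewrite -scaleN1r cdotZ mulN1r. Qed.

Lemma cdotB n (u v w : 'cV[C]_n) : cdot u (v - w) = cdot u v - cdot u w.
Proof. by rewrite cdotD cdotN. Qed.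

Lemma cdot_sum n (u : 'cV[C]_n) (I : Type) (r : seq I) (P : pred I)
    (F : I -> 'cV[C]_n) :
  cdot u (\sum_(i <- r | P i) F i) = \sum_(i <- r | P i) cdot u (F i).
Proof.
by apply: (big_morph (cdot u)); [exact: cdotD | exact: cdot0].
Qed.

Lemma cdotDl n (u v w : 'cV[C]_n) : cdot (v + w) u = cdot v u + cdot w u.
Proof. by rewrite !(cdotC _ u) cdotD rmorphD. Qed.

Lemma cdotZl n (u v : 'cV[C]_n) a : cdot (a *: v) u = a^* * cdot v u.
Proof. by rewrite !(cdotC _ u) cdotZ rmorphM. Qed.

Lemma cdotBl n (u v w : 'cV[C]_n) : cdot (v - w) u = cdot v u - cdot w u.
Proof. by rewrite !(cdotC _ u) cdotB rmorphB. Qed.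

Lemma cdot_suml n (u : 'cV[C]_n) (I : Type) (r : seq I) (P : pred I)
    (F : I -> 'cV[C]_n) :
  cdot (\sum_(i <- r | P i) F i) u = \sum_(i <- r | P i) cdot (F i) u.
Proof.
by rewrite cdotC cdot_sum rmorph_sum; apply: eq_bigr => i _; rewrite [RHS]cdotC.
Qed.

Lemma cdot_adj m n (A : 'M[C]_(m, n)) u v :
  cdot u (A *m v) = cdot (A^t* *m u) v.
Proof. by rewrite /cdot trmx_mul map_mxM /= trmxCK mulmxA. Qed.

Lemma cdot_normE n (u : 'cV[C]_n) : cdot u u = \sum_i `|u i 0| ^+ 2.
Proof. by rewrite cdotE; apply: eq_bigr => i _; rewrite normCKC. Qed.

Lemma cdot_ge0 n (u : 'cV[C]_n) : 0 <= cdot u u.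
Proof. by rewrite cdot_normE sumr_ge0 // => i _; rewrite exprn_ge0. Qed.

Lemma cdot_eq0 n (u : 'cV[C]_n) : (cdot u u == 0) = (u == 0).
Proof.
apply/eqP/eqP => [|->]; last exact: cdot0.
rewrite cdot_normE => /eqP; rewrite psumr_eq0 => [/allP u0|i _]; last first.
  by rewrite exprn_ge0.
apply/colP => i; rewrite mxE; apply/eqP.
by have := u0 i (mem_index_enum i); rewrite sqrf_eq0 normr_eq0.
Qed.

Lemma unitary_adj_mul n (U : 'M[C]_n) : U \is unitarymx -> U^t* *m U = 1%:M.
Proof. by move/unitarymxP/mulmx1C. Qed.

Lemma unitarymx1 n : (1%:M : 'M[C]_n) \is unitarymx.
Proof. by apply/unitarymxP; rewrite trmx1 map_mx1 mulmx1. Qed.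

Lemma involution_unitary n (U : 'M[C]_n) :
  U^t* = U -> U *m U = 1%:M -> U \is unitarymx.
Proof. by move=> Uh UU; apply/unitarymxP; rewrite Uh. Qed.

Section OrthonormalFamily.
Variables (n : nat) (X : finType).
Implicit Types p q : X -> 'cV[C]_n.

Definition orthonormal_family p := forall x y, cdot (p x) (p y) = (x == y)%:R.

Definition outer (u : 'cV[C]_n) : 'M[C]_n := u *m u^t*.

Lemma outer_mul u v : outer u *m v = cdot u v *: u.
Proof. by rewrite /outer -mulmxA mul_adj_cdot mul_mx_scalar. Qed.

Lemma adj_outer u : (outer u)^t* = outer u.
Proof. by rewrite /outer trmx_mul map_mxM /= trmxCK. Qed.

(** With [w] the projection of [v] onto the span of the family, the squared norm of [v - w] is
    [cdot v v - cdot w v], and it is nonnegative. This lets the success probability be bounded from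
    below by components along good vectors alone. *)
Lemma bessel p v : orthonormal_family p ->
  \sum_x `|cdot (p x) v| ^+ 2 <= cdot v v.
Proof.
move=> pO; set w := \sum_x cdot (p x) v *: p x.
have dpw y : cdot (p y) w = cdot (p y) v.
  rewrite cdot_sum (bigD1 y) //= cdotZ pO eqxx mulr1 big1 ?addr0 // => x xy.
  by rewrite cdotZ pO eq_sym (negPf xy) mulr0.
have wv : cdot w v = \sum_x `|cdot (p x) v| ^+ 2.
  by rewrite cdot_suml; apply: eq_bigr => x _; rewrite cdotZl normCKC.
have ww : cdot w w = cdot w v.
  by rewrite !(cdot_suml w) !cdot_suml; apply: eq_bigr => x _;
     rewrite !cdotZl dpw.
have wvC : cdot v w = cdot w v.
  rewrite cdotC wv conj_Creal // ger0_real // sumr_ge0 // => x _.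
  by rewrite exprn_ge0.
have := cdot_ge0 (v - w).
by rewrite cdotB !cdotBl ww wvC subrr subr0 subr_ge0 wv.
Qed.

(* The gates are locked, so that unification never compares their entries. *)
Definition swap_mx p q : 'M[C]_n :=
  locked_with swap_key (1%:M - \sum_x outer (p x - q x)).

Lemma swap_mulE p q v :
  swap_mx p q *m v = v - \sum_x (cdot (p x) v - cdot (q x) v) *: (p x - q x).
Proof.
rewrite /swap_mx unlock mulmxBl mul1mx mulmx_suml; congr (_ - _).
by apply: eq_bigr => x _; rewrite outer_mul cdotBl.
Qed.

Section Swap.
Variables p q : X -> 'cV[C]_n.
Hypotheses (pO : orthonormal_family p) (qO : orthonormal_family q).
Hypothesis pq0 : forall x y, cdot (p x) (q y) = 0.

Lemma swap_mul x : swap_mx p q *m p x = q x.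
Proof.
rewrite swap_mulE (bigD1 x) //= big1 => [|y /negPf yx].
  by rewrite pO eqxx cdotC pq0 conjC0 subr0 scale1r addr0 opprB addrC subrK.
by rewrite pO yx cdotC pq0 conjC0 subrr scale0r.
Qed.

Lemma swap_mulV x : swap_mx p q *m q x = p x.
Proof.
rewrite swap_mulE (bigD1 x) //= big1 => [|y /negPf yx].
  by rewrite qO eqxx pq0 sub0r addr0 scaleN1r opprK addrC subrK.
by rewrite qO yx pq0 subrr scale0r.
Qed.

(** The differences [p x - q x] are orthogonal with squared norm 2, so this is a product of
    commuting reflections, hence a Hermitian involution. *)
Lemma swap_unitary : swap_mx p q \is unitarymx.
Proof.
apply: involution_unitary.
  rewrite /swap_mx unlock linearB /= map_mxB trmx1 map_mx1 linear_sum map_mx_sum /=.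
  by congr (_ - _); apply: eq_bigr => x _; rewrite adj_outer.
rewrite {2}/swap_mx unlock mulmxBr mulmx1 mulmx_sumr.
rewrite [X in _ - X](_ : _ = - \sum_x outer (p x - q x)); last first.
  rewrite -sumrN; apply: eq_bigr => x _.
  by rewrite /outer mulmxA mulmxBr swap_mul swap_mulV -mulNmx opprB.
by rewrite opprK /swap_mx unlock subrK.
Qed.

End Swap.

(** For an orthonormal [p], this is diagonal with entries [f x] on the span of the family and the
    identity on its orthogonal complement. *)
Definition phase_mx p (f : X -> C) : 'M[C]_n :=
  locked_with phase_key (1%:M + \sum_x (f x - 1) *: outer (p x)).

Lemma phase_mulE p f v :
  phase_mx p f *m v = v + \sum_x ((f x - 1) * cdot (p x) v) *: p x.
Proof.
rewrite /phase_mx unlock mulmxDl mul1mx mulmx_suml; congr (_ + _).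
by apply: eq_bigr => x _; rewrite -scalemxAl outer_mul scalerA.
Qed.

Lemma phase_unitary p f : orthonormal_family p ->
  (forall x, `|f x| = 1) -> phase_mx p f \is unitarymx.
Proof.
move=> pO f1; apply/unitarymxP.
rewrite {2}/phase_mx unlock linearD /= map_mxD trmx1 map_mx1 linear_sum map_mx_sum /=.
rewrite mulmxDr mulmx1 mulmx_sumr {1}/phase_mx unlock -addrA.
rewrite [X in 1%:M + X](_ : _ = 0) ?addr0 // -big_split /= big1 // => x _.
rewrite linearZ /= map_mxZ /= adj_outer -scalemxAr {2}/outer mulmxA.
rewrite -/(phase_mx p f) phase_mulE (bigD1 x) //= big1 => [|y /negPf yx].
  rewrite pO eqxx mulr1 addr0 mulmxDl -scalemxAl -/(outer _) -{2}[outer _]scale1r.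
  rewrite -scalerDl (addrC 1) subrK scalerA -scalerDl.
  rewrite [X in X *: _](_ : _ = 0) ?scale0r //.
  rewrite rmorphB rmorph1 mulrBl mul1r -normCKC f1 expr1n.
  by rewrite addrC addrA subrK subrr.
by rewrite pO yx mulr0 scale0r.
Qed.

End OrthonormalFamily.
End InnerProduct.

(** * Phase estimation with the cyclic shift *)

Section PhaseEstimation.
Variable C : numClosedFieldType.

Definition shift_mx n : 'M[C]_n := perm_mx (perm (@ordS_inj n)).

Lemma shift_mulE n (v : 'cV[C]_n) i : (shift_mx n *m v) i 0 = v (ordS i) 0.
Proof. by rewrite /shift_mx -row_permE mxE permE. Qed.

Lemma shift_unitary n : shift_mx n \is unitarymx.
Proof.
apply/unitarymxP; rewrite /shift_mx tr_perm_mx map_perm_mx -perm_mxM mulgV.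
exact: perm_mx1.
Qed.

Lemma normal_spectral n (A : 'M[C]_n) : A \is normalmx ->
  spectralmx A *m A = diag_mx (spectral_diag A) *m spectralmx A.
Proof.
move=> /orthomx_spectralP {2}->.
by rewrite mulmxA mulmxA mulmxV ?spectral_unit // mul1mx.
Qed.

Lemma cdot_unitary n (U : 'M[C]_n) u v : U \is unitarymx ->
  cdot (U *m u) (U *m v) = cdot u v.
Proof.
by move=> Uu; rewrite cdot_adj mulmxA unitary_adj_mul // mul1mx.
Qed.

(* Measuring v in an eigenbasis of A gives eigenvalues whose mean square
   distance to z is |(z - A) v|^2. *)
Lemma spectral_second_moment n (A : 'M[C]_n) z v : A \is normalmx ->
  \sum_y `|z - spectral_diag A 0 y| ^+ 2 * `|(spectralmx A *m v) y 0| ^+ 2 =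
  cdot (z *: v - A *m v) (z *: v - A *m v).
Proof.
move=> An; rewrite -(cdot_unitary _ _ (spectral_unitarymx A)) cdot_normE.
apply: eq_bigr => y _; rewrite -exprMn -normrM; congr (`|_| ^+ 2).
rewrite mulmxBr mulmxA normal_spectral // -mulmxA -scalemxAr.
by rewrite [in RHS]mxE mul_diag_mx !mxE mulrBl.
Qed.

Definition window n (k : nat) : nat := (k * (n - k))%N.

Lemma sum_window_sqr n : 
  30%:R * \sum_(k < n) (window n k)%:R ^+ 2 = n%:R ^+ 5 - n%:R :> C.
Proof.
(* The partial sums up to [m], with [n] fixed in the summand, have a closed form amenable to
   induction; it becomes the claim at [m = n]. *)
suff H m : (m <= n)%N -> 30%:R * \sum_(k < m) (window n k)%:R ^+ 2 =
   (m%:R * (m%:R - 1) * (5%:R * n%:R ^+ 2 * (2%:R * m%:R - 1)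
     - 15%:R * n%:R * m%:R * (m%:R - 1)
     + (2%:R * m%:R - 1) * (3%:R * m%:R ^+ 2 - 3%:R * m%:R - 1))) :> C.
  by rewrite H //; ring.
elim: m => [|m IH] mn; first by rewrite big_ord0; ring.
rewrite big_ord_recr /= mulrDr IH 1?ltnW // /window natrM natrB 1?ltnW //.
rewrite -natr1; ring.
Qed.

Definition window_vec n (z : C) : 'cV[C]_n :=
  (sqrtC (\sum_(k < n) (window n k)%:R ^+ 2))^-1 *:
    \col_(k < n) ((window n k)%:R * z ^+ k).

Lemma window_vec_norm n z : (1 < n)%N -> `|z| = 1 ->
  cdot (window_vec n z) (window_vec n z) = 1.
Proof.
move=> n1 z1; rewrite /window_vec; set S := \sum_(k < n) _.
have S0 : 0 < S.
  have : (0 : C) < 30%:R * S.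
    rewrite sum_window_sqr subr_gt0 -natrX ltr_nat.
    by rewrite -[X in (X < _)%N]expn1 ltn_exp2l.
  by rewrite pmulr_rgt0 // ltr0n.
rewrite cdotZ cdotZl cdot_normE mulrA (eq_bigr (fun k : 'I_n => (window n k)%:R ^+ 2)).
  rewrite geC0_conj ?invr_ge0 ?sqrtC_ge0 ?(ltW S0) //.
  by rewrite -invfM -expr2 sqrtCK mulVf // gt_eqF.
by move=> k _; rewrite mxE normrM normrX z1 expr1n mulr1 normr_nat.
Qed.

Lemma window_vec0 n z (k : 'I_n) : val k = 0%N -> window_vec n z k 0 = 0.
Proof. by move=> k0; rewrite !mxE k0 /window mul0n mul0r mulr0. Qed.

Lemma window_vec_phase n z (k : 'I_n) :
  window_vec n z k 0 = window_vec n 1 k 0 * z ^+ k.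
Proof. by rewrite !mxE expr1n mulr1 mulrA. Qed.

Lemma phase_estimation n z : (1 < n)%N -> `|z| = 1 ->
  \sum_y `|z - spectral_diag (shift_mx n) 0 y| ^+ 2
     * `|(spectralmx (shift_mx n) *m window_vec n z) y 0| ^+ 2
  <= 60%:R / n%:R ^+ 2.
Proof.
move=> n1 z1; rewrite spectral_second_moment; last first.
  apply/normalmxP.
  by rewrite unitary_adj_mul ?shift_unitary //; apply/unitarymxP/shift_unitary.
rewrite cdot_normE /window_vec; set S := (X in sqrtC X).
have n0 : 0 < n%:R :> C by rewrite ltr0n (ltn_trans _ n1).
have SE : 30%:R * S = n%:R ^+ 5 - n%:R by exact: sum_window_sqr.
(* [30 S = n^5 - n] is at least [n^5 / 2] as soon as [2 <= n^4]. *)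
have S0 : n%:R ^+ 5 <= 60%:R * S.
  rewrite (_ : 60%:R = 2%:R * 30%:R :> C); last by rewrite -natrM.
  rewrite -mulrA SE mulrBr -subr_ge0.
  rewrite (_ : _ - _ = n%:R ^+ 5 - 2%:R * n%:R); last by ring.
  rewrite subr_ge0 -natrX -natrM ler_nat.
  have: (2 ^ 4 <= n ^ 4)%N by rewrite leq_exp2r.
  by move=> h; rewrite (expnSr n 4) leq_mul2r (leq_trans _ h) ?orbT.
have Sp : 0 < S.
  have : (0 : C) < 60%:R * S by apply: lt_le_trans S0; rewrite exprn_gt0.
  by rewrite pmulr_rgt0 // ltr0n.
(* Each of the [n] increments of the unnormalized window has modulus at most [n]; this leaves
   [n^3 / S], which is at most [60 / n^2]. *)
apply: (@le_trans _ _ (\sum_(k < n) n%:R ^+ 2 / S)).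
  apply: ler_sum => k _; rewrite mxE [X in _ + X]mxE shift_mulE !mxE.
  rewrite mulrCA -mulrBr normrM exprMn mulrC normfV.
  rewrite [X in _ * X^-1 ^+ 2]ger0_norm ?sqrtC_ge0 ?(ltW Sp) // exprVn sqrtCK.
  rewrite ler_pM2r ?invr_gt0 //.
  (* The shift wraps around at [k = n - 1], but [window n n] and [window n 0] both vanish, so the
     formula with [k.+1] holds there too. *)
  have -> : z * ((window n k)%:R * z ^+ k) -
            (window n (ordS k))%:R * z ^+ ordS k =
            ((window n k)%:R - (window n k.+1)%:R) * z ^+ k.+1.
    rewrite /= mulrBl exprS; congr (_ - _); first by ring.
    have [kn|] := ltnP k.+1 n; first by rewrite modn_small // exprS.
    move=> nk; have -> : k.+1 = n by apply/eqP; rewrite eqn_leq nk ltn_ord.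
    by rewrite modnn /window subnn muln0 mul0n !mul0r.
  rewrite normrM normrX z1 expr1n mulr1 lerXn2r ?nnegrE ?normr_ge0 ?ler0n //.
  rewrite /window !natrM !natrB ?ltn_ord ?(ltnW (ltn_ord k)) //.
  rewrite (_ : _ - _ = (k.*2.+1)%:R - n%:R); last first.
    by rewrite -natr1 -[in RHS]natr1 -muln2 natrM; ring.
  have kn := ltn_ord k.
  have [nk|/ltnW nk] := leqP n k.*2.+1.
    by rewrite -natrB // normr_nat ler_nat; lia.
  by rewrite distrC -natrB // normr_nat ler_nat; lia.
rewrite sumr_const card_ord -mulrnAl ler_pdivrMr // mulrAC ler_pdivlMr ?exprn_gt0 //.
rewrite -mulr_natr -mulrA -!exprS -exprD.
exact: S0.
Qed.

End PhaseEstimation.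

(** * Projections onto eigenspaces *)

Section Eigenprojections.
Variables (R : realType) (n : nat).
Local Notation C := R[i].
Implicit Types (A : 'M[C]_n) (psi u v : 'cV[C]_n).

Lemma hermsym_adj A : A \is hermsymmx -> A^t* = A.
Proof.
by move=> /is_hermitianmxP; rewrite expr0 scale1r => {2}->.
Qed.

Lemma eigprojP A l psi : A *m eigproj A l psi = l *: eigproj A l psi.
Proof.
have /eigenspaceP : (psi^T *m proj_ortho (eigenspace A^T l) <= eigenspace A^T l)%MS.
  exact: proj_ortho_sub.
by move=> /(congr1 trmx); rewrite trmx_mul trmxK linearZ.
Qed.

(** The residue [psi - eigproj A l psi] is orthogonal to the eigenspace, which contains [u]. *)
Lemma eigproj_cdot A l psi u : A *m u = l *: u ->
  cdot u (eigproj A l psi) = cdot u psi.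
Proof.
move=> Au; apply/esym/eqP; rewrite -subr_eq0 -cdotB; apply/eqP.
have uE : (u^T <= eigenspace A^T l)%MS.
  by apply/eigenspaceP; rewrite -trmx_mul Au linearZ.
have := proj_ortho_compl_sub (eigenspace A^T l) psi^T.
rewrite -(submx_ortho _ u^T) in uE *.
move=> /submx_trans => /(_ _ _ uE).
move=> /orthomx1P /matrixP/(_ 0 0); rewrite mxE [RHS]mxE => h.
rewrite cdotE -[RHS]h; apply: eq_bigr => i _.
by rewrite !mxE mulrC.
Qed.

Lemma eigen_orth A l m u v : A \is hermsymmx -> l \is Num.real -> m != l ->
  A *m u = l *: u -> A *m v = m *: v -> cdot u v = 0.
Proof.
move=> Ah lr ml Au Av; have := cdot_adj A u v.
rewrite hermsym_adj // Av Au cdotZ cdotZl (CrealP lr) => /eqP.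
by rewrite -subr_eq0 -mulrBl mulf_eq0 subr_eq0 (negPf ml) /= => /eqP.
Qed.

Lemma eigvals_real A l : A \is hermsymmx -> l \in eigvals A -> l \is Num.real.
Proof.
move=> /hermitian_spectral_diag_real /mxOverP sr.
by rewrite mem_undup => /mapP[i _ ->].
Qed.

Lemma spectral_eigenvector A i : A \is hermsymmx ->
  let e := col i ((spectralmx A)^t*) in A *m e = spectral_diag A 0 i *: e.
Proof.
move=> Ah e; have An := hermitian_normalmx Ah.
have := congr1 (fun M : 'M_n => M^t*) (normal_spectral An).
rewrite /= !trmx_mul !map_mxM /= hermsym_adj // => h.
rewrite /e !colE mulmxA h -!colE tr_diag_mx map_diag_mx mul_mx_diag.
apply/colP => j; rewrite !mxE mulrC; congr (_ * _).
by apply/CrealP; move/mxOverP: (hermitian_spectral_diag_real Ah); apply.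
Qed.

(** Both sides are tested against an eigenbasis: an eigenvector [e] is orthogonal to all the
    projections except the one for its own eigenvalue, whose inner product with [e] is that of
    [psi]. *)
Lemma sum_eigproj A psi : A \is hermsymmx ->
  \sum_(l <- eigvals A) eigproj A l psi = psi.
Proof.
move=> Ah; apply/eqP; rewrite -subr_eq0; set x := _ - _; apply/eqP.
have Pu := spectral_unitarymx A.
suff Px : spectralmx A *m x = 0.
  by rewrite -[x]mul1mx -(unitary_adj_mul Pu) -mulmxA Px mulmx0.
apply/colP => i; rewrite [RHS]mxE.
set e := col i ((spectralmx A)^t*).
have -> : (spectralmx A *m x) i 0 = cdot e x.
  rewrite cdotE mxE; apply: eq_bigr => j _; rewrite !mxE.
  by congr (_ * _); rewrite conjCK.
have eA := spectral_eigenvector i Ah.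
have lE : spectral_diag A 0 i \in eigvals A.
  by rewrite mem_undup; apply/mapP; exists i; rewrite ?mem_enum.
rewrite cdotB cdot_sum (bigD1_seq _ lE (undup_uniq _)) /= big1 ?addr0.
  by rewrite eigproj_cdot // subrr.
move=> l ll; apply: eigen_orth eA (eigprojP A l psi) => //.
exact: eigvals_real lE.
Qed.

Lemma eigproj_orth A l m psi : A \is hermsymmx -> l \is Num.real -> m != l ->
  cdot (eigproj A l psi) (eigproj A m psi) = 0.
Proof.
by move=> Ah lr ml; apply: (eigen_orth Ah lr ml); apply: eigprojP.
Qed.

Lemma sum_eigproj_norm A psi : A \is hermsymmx ->
  \sum_(l <- eigvals A) cdot (eigproj A l psi) (eigproj A l psi) = cdot psi psi.
Proof.
move=> Ah; rewrite -[in RHS](sum_eigproj psi Ah) cdot_suml; apply: eq_bigr => l _.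
by rewrite sum_eigproj // eigproj_cdot // eigprojP.
Qed.

End Eigenprojections.

(** As [Cl j] is Hermitian and unitary, the squared norms of [psi + Cl j *m psi] and
    [psi - Cl j *m psi] are twice [cdot psi psi] plus or minus [cdot psi (Cl j *m psi)]. Hence the
    latter is at most [cdot psi psi] in modulus, and averaging over [b] preserves the bound. *)
Lemma convex_unitary_eigenvalue (R : realType) (n M : nat) (b : 'I_M -> R)
    (Cl : 'I_M -> 'M[R[i]]_n) (l : R[i]) (psi : 'cV[R[i]]_n) :
  (forall j, 0 <= b j) -> \sum_j b j = 1 ->
  (forall j, Cl j \is hermsymmx) -> (forall j, Cl j \is unitarymx) ->
  l \is Num.real -> psi != 0 ->
  (\sum_j (b j)%:C%C *: Cl j) *m psi = l *: psi -> `|l| <= 1.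
Proof.
move=> b0 b1 Ch Cu lr psi0 /(congr1 (cdot psi)).
have bnd j : `|cdot psi (Cl j *m psi)| <= cdot psi psi.
  set c := cdot _ _.
  have cr : c \is Num.real.
    by apply/CrealP; rewrite /c -cdotC cdot_adj hermsym_adj.
  have CC : cdot (Cl j *m psi) (Cl j *m psi) = cdot psi psi.
    by rewrite cdot_unitary.
  have Cc : cdot (Cl j *m psi) psi = c by rewrite cdotC (CrealP cr).
  rewrite real_ler_norml //; apply/andP; split.
    rewrite -subr_ge0 opprK -(@pmulrn_lge0 _ _ 2) //.
    have := cdot_ge0 (psi + Cl j *m psi).
    by rewrite cdotD !cdotDl CC Cc -/c mulr2n addrACA (addrC _ c).
  rewrite -subr_ge0 -(@pmulrn_lge0 _ _ 2) //.
  have := cdot_ge0 (psi - Cl j *m psi).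
  rewrite cdotB !cdotBl CC Cc -/c mulr2n.
  by rewrite [in X in X -> _]opprB.
rewrite cdotZ mulmx_suml cdot_sum => /(congr1 Num.norm) e.
have p0 : 0 < cdot psi psi by rewrite lt_def cdot_eq0 psi0 cdot_ge0.
rewrite -(ler_pM2r p0) mul1r -{1}(ger0_norm (ltW p0)) -normrM -e.
apply: le_trans (ler_norm_sum _ _ _) _.
rewrite -[leRHS]mul1r -(rmorph1 (real_complex R)) -b1 rmorph_sum mulr_suml.
apply: ler_sum => j _; rewrite -scalemxAl cdotZ normrM ger0_norm ?lecR //.
by rewrite ler_wpM2l ?lecR.
Qed.

(** * Tensor products of states *)

Section Tensors.
Variable R : realType.
Local Notation C := R[i].

Lemma tens_tensv m n p q (A : 'M[C]_(m, n)) (B : 'M[C]_(p, q)) u v :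
  (A *t B) *m tensv u v = tensv (A *m u) (B *m v).
Proof. exact: (@tensmx_mul C m n p q 1 1). Qed.

Lemma tens_adj m n p q (A : 'M[C]_(m, n)) (B : 'M[C]_(p, q)) :
  (A *t B)^t* = A^t* *t B^t*.
Proof. by rewrite trmx_tens map_mxT. Qed.

Lemma tens1 m n : (1%:M : 'M[C]_m) *t (1%:M : 'M[C]_n) = 1%:M.
Proof.
apply/matrixP => x y; case: (mxtens_indexP x) => i k.
case: (mxtens_indexP y) => j l; rewrite tensmxE !mxE -natrM mulnb.
by rewrite (can_eq (@mxtens_indexK _ _)).
Qed.

Lemma tens_unitary m n (A : 'M[C]_m) (B : 'M[C]_n) :
  A \is unitarymx -> B \is unitarymx -> A *t B \is unitarymx.
Proof.
move=> /unitarymxP Au /unitarymxP Bu; apply/unitarymxP.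
by rewrite tens_adj tensmx_mul Au Bu tens1.
Qed.

Lemma tensDr m n p q (A : 'M[C]_(m, n)) (B B' : 'M[C]_(p, q)) :
  A *t (B + B') = A *t B + A *t B'.
Proof. by apply/matrixP => i j; rewrite !mxE mulrDr. Qed.

Lemma tensvE m n (u : 'cV[C]_m) (v : 'cV[C]_n) i j :
  tensv u v (mxtens_index (i, j)) 0 = u i 0 * v j 0.
Proof.
rewrite /tensv !mxE mxtens_indexK /=.
by rewrite (ord1 (Ordinal _)) [X in v _ X]ord1.
Qed.

Lemma sum_tens m n (F : 'I_(m * n) -> C) :
  \sum_x F x = \sum_i \sum_j F (mxtens_index (i, j)).
Proof.
rewrite pair_big /= (reindex (@mxtens_index m n)) /=; last first.
  exists (@mxtens_unindex m n) => x _; first exact: mxtens_indexK.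
  exact: mxtens_unindexK.
by apply: eq_bigr => -[].
Qed.

Lemma cdot_tensv m n (u u' : 'cV[C]_m) (v v' : 'cV[C]_n) :
  cdot (tensv u v) (tensv u' v') = cdot u u' * cdot v v'.
Proof.
rewrite !cdotE sum_tens mulr_suml; apply: eq_bigr => i _.
rewrite mulr_sumr; apply: eq_bigr => j _.
by rewrite !tensvE rmorphM /=; ring.
Qed.

Lemma tensvZl m n (u : 'cV[C]_m) (v : 'cV[C]_n) c :
  tensv (c *: u) v = c *: tensv u v.
Proof. by apply/colP => i; rewrite !mxE mulrA. Qed.

Lemma tensvZr m n (u : 'cV[C]_m) (v : 'cV[C]_n) c :
  tensv u (c *: v) = c *: tensv u v.
Proof. by apply/colP => i; rewrite !mxE mulrCA. Qed.

Lemma tensv_suml m n (I : Type) (r : seq I) (F : I -> 'cV[C]_m) (v : 'cV[C]_n) :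
  tensv (\sum_(i <- r) F i) v = \sum_(i <- r) tensv (F i) v.
Proof.
apply/colP => i; rewrite mxE !summxE mulr_suml; apply: eq_bigr => j _.
by rewrite [RHS]mxE.
Qed.

Lemma tensv_sumr m n (I : Type) (r : seq I) (u : 'cV[C]_m) (F : I -> 'cV[C]_n) :
  tensv u (\sum_(i <- r) F i) = \sum_(i <- r) tensv u (F i).
Proof.
apply/colP => i; rewrite mxE !summxE mulr_sumr; apply: eq_bigr => j _.
by rewrite [RHS]mxE.
Qed.

Lemma cdot_ket n (i j : 'I_n) : cdot (ket R i) (ket R j) = (i == j)%:R.
Proof.
rewrite cdotE (bigD1 i) //= big1 => [|k ki]; rewrite !mxE ?eqxx.
  by rewrite conjC1 mul1r andbT addr0.
by rewrite (negPf ki) conjC0 mul0r.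
Qed.

Lemma cdot_ketl n (i : 'I_n) v : cdot (ket R i) v = v i 0.
Proof.
rewrite cdotE (bigD1 i) //= big1 => [|k ki]; rewrite !mxE ?eqxx.
  by rewrite conjC1 mul1r addr0.
by rewrite (negPf ki) conjC0 mul0r.
Qed.

Lemma ket_basis n (v : 'cV[C]_n) : v = \sum_i v i 0 *: ket R i.
Proof.
apply/colP => i; rewrite summxE (bigD1 i) //= big1 => [|k /negPf ki].
  by rewrite !mxE !eqxx mulr1 addr0.
by rewrite !mxE eq_sym ki mulr0.
Qed.

Lemma cdot_ket0 n : (0 < n)%N -> cdot (ket0 R n) (ket0 R n) = 1.
Proof.
case: n => // n _; rewrite (_ : ket0 R n.+1 = ket R ord0) ?cdot_ket //.
by apply/colP => i; rewrite !mxE -val_eqE andbT.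
Qed.

Lemma cdot_isometry m n (V : 'M[C]_(m, n)) u v : isometry_mx V ->
  cdot (V *m u) (V *m v) = cdot u v.
Proof. by move=> VV; rewrite cdot_adj mulmxA VV mul1mx. Qed.

Lemma diag_mx_unitary n (d : 'rV[C]_n) :
  (forall i, `|d 0 i| = 1) -> diag_mx d \is unitarymx.
Proof.
move=> d1; apply/unitarymxP; rewrite tr_diag_mx map_diag_mx mulmx_diag.
apply/matrixP => i j; rewrite !mxE; congr (_ *+ _).
by rewrite -normCK d1 expr1n.
Qed.

Lemma diag_mx_ket n (d : 'rV[C]_n) x :
  diag_mx d *m ket R x = d 0 x *: ket R x.
Proof.
rewrite mul_diag_mx; apply/colP => i; rewrite !mxE.
by have [->|] := eqVneq i x; rewrite // !mulr0.
Qed.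

Definition kbit (b : bool) : 'cV[C]_2 := ket R (if b then ord_max else 0).

Lemma cdot_kbit b b' : cdot (kbit b) (kbit b') = (b == b')%:R.
Proof. by rewrite cdot_ket; case: b b' => -[]. Qed.

Lemma controlled_mul n (A : 'M[C]_n) b v :
  controlled A *m tensv (kbit b) v = tensv (kbit b) (if b then A *m v else v).
Proof.
rewrite /controlled mulmxDl !tens_tensv /kbit /ket mul1mx.
by case: b; rewrite ?mul_delta_mx ?mul_delta_mx_0 // /tensv tens0mx ?add0r ?addr0.
Qed.

Definition not_mx : 'M[C]_2 := delta_mx 0 ord_max + delta_mx ord_max 0.

Lemma not_mulE b : not_mx *m kbit b = kbit (~~ b).
Proof.
rewrite /not_mx /kbit /ket mulmxDl.
by case: b; rewrite /= mul_delta_mx mul_delta_mx_0 // ?addr0 ?add0r.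
Qed.

Lemma not_adj : not_mx^t* = not_mx.
Proof.
apply/matrixP => i j; rewrite !mxE rmorphD /= !conjC_nat addrC.
by rewrite andbC (andbC (j == _)).
Qed.

Lemma not_sqr : not_mx *m not_mx = 1%:M.
Proof.
rewrite /not_mx mulmxDl !mulmxDr !mul_delta_mx !mul_delta_mx_0 //.
apply/matrixP => i j; rewrite !mxE add0r addr0.
by case: i => -[|[]] // ?; case: j => -[|[]] // ?; rewrite -!val_eqE /= ?addr0 ?add0r.
Qed.

(** A NOT controlled by a projection is Hermitian, and its square is the identity because the cross
    terms [P (1 - P)] vanish. *)
Lemma cond_not_unitary n (P : 'M[C]_n) : P^t* = P -> P *m P = P ->
  not_mx *t P + 1%:M *t (1%:M - P) \is unitarymx.
Proof.
move=> Ph PP; apply: involution_unitary.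
  rewrite linearD /= map_mxD /= !tens_adj not_adj Ph trmx1 map_mx1.
  by rewrite linearB /= map_mxB trmx1 map_mx1 Ph.
rewrite mulmxDl !mulmxDr !tensmx_mul not_sqr !mul1mx !mulmx1 PP.
have -> : P *m (1%:M - P) = 0 by rewrite mulmxBr mulmx1 PP subrr.
have Q : (1%:M - P) *m P = 0 by rewrite mulmxBl mul1mx PP subrr.
rewrite Q mulmxBr mulmx1 Q subr0 !tensmx0 addr0 add0r -tensDr addrC subrK.
exact: tens1.
Qed.

End Tensors.

(** * Gates and the loader *)

Fact on_work_key : unit.
Proof. exact: tt. Qed.

Fact flip_key : unit.
Proof. exact: tt. Qed.

Fact run_key : unit.
Proof. exact: tt. Qed.

Section Gates.
Variables (R : realType) (dI nw N tJ tW a : nat).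
Local Notation C := R[i].
Local Notation D := (regdim dI nw N tJ tW a).
Local Notation nW := (2 ^ nw)%N.

Definition st (c : bool) (i : 'cV[C]_dI) (v : 'cV[C]_nW) (phi : 'cV[C]_N)
    (t : 'cV[C]_(tJ * tW)) (al : 'cV[C]_a) : 'cV[C]_D :=
  tensv (kbit R c) (tensv i (tensv (tensv v phi) (tensv t al))).

Definition on_work (U : 'M[C]_a) : 'M[C]_D :=
  locked_with on_work_key (1%:M *t (1%:M *t (1%:M *t (1%:M *t U)))).

(** Toggles the control qubit on the work states satisfying [p]. Placed around a query, it makes the
    query conditional on the work register. *)
Definition flip_mx (p : pred 'I_a) : 'M[C]_D :=
  let P := 1%:M *t (1%:M *t (1%:M *t diag_mx (\row_x (p x)%:R))) in
  locked_with flip_key (not_mx R *t P + 1%:M *t (1%:M - P)).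

Lemma cdot_st c i v phi t al c' i' v' phi' t' al' :
  cdot (st c i v phi t al) (st c' i' v' phi' t' al') =
  (c == c')%:R * cdot i i' * cdot v v' * cdot phi phi' * cdot t t' * cdot al al'.
Proof. by rewrite /st !cdot_tensv cdot_kbit !mulrA. Qed.

Lemma st_sumi (I : Type) (r : seq I) c F (w : I -> C) v phi t al :
  st c (\sum_(j <- r) w j *: F j) v phi t al = \sum_(j <- r) w j *: st c (F j) v phi t al.
Proof.
rewrite /st tensv_suml tensv_sumr; apply: eq_bigr => j _.
by rewrite tensvZl tensvZr.
Qed.

Lemma st_sumphi (I : Type) (r : seq I) c i v (w : I -> C) F t al :
  st c i v (\sum_(j <- r) w j *: F j) t al = \sum_(j <- r) w j *: st c i v (F j) t al.
Proof.
rewrite /st tensv_sumr tensv_suml !tensv_sumr; apply: eq_bigr => j _.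
by rewrite tensvZr tensvZl !tensvZr.
Qed.

Lemma st_sumal (I : Type) (r : seq I) c i v phi t (w : I -> C) F :
  st c i v phi t (\sum_(j <- r) w j *: F j) = \sum_(j <- r) w j *: st c i v phi t (F j).
Proof.
rewrite /st !tensv_sumr; apply: eq_bigr => j _.
by rewrite !tensvZr.
Qed.

Lemma on_work_unitary U : U \is unitarymx -> on_work U \is unitarymx.
Proof. by move=> Uu; rewrite /on_work unlock !tens_unitary ?unitarymx1. Qed.

Lemma on_work_st U c i v phi t al :
  on_work U *m st c i v phi t al = st c i v phi t (U *m al).
Proof. by rewrite /on_work unlock /st !tens_tensv !mul1mx. Qed.

Lemma on_work_adj U : (on_work U)^t* = on_work (U^t*).
Proof.
by rewrite /on_work !unlock tens_adj tens_adj tens_adj tens_adj !trmx1 !map_mx1.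
Qed.

Lemma flip_unitary p : flip_mx p \is unitarymx.
Proof.
rewrite /flip_mx unlock; apply: cond_not_unitary.
  rewrite !tens_adj !trmx1 !map_mx1 tr_diag_mx map_diag_mx.
  set d := map_mx _ _; rewrite (_ : d = \row_x (p x)%:R) //.
  by apply/rowP => x; rewrite !mxE rmorph_nat.
rewrite !tensmx_mul !mulmx1 mulmx_diag; set d := \row_i _.
rewrite (_ : d = \row_x (p x)%:R) //.
by apply/rowP => x; rewrite !mxE -natrM mulnb andbb.
Qed.

Lemma flip_st p c i v phi t x :
  flip_mx p *m st c i v phi t (ket R x) = st (c (+) p x) i v phi t (ket R x).
Proof.
rewrite /flip_mx unlock /st mulmxDl !tens_tensv mulmxBl !tens_tensv !mul1mx not_mulE.
rewrite diag_mx_ket mxE.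
case: (p x); rewrite ?scale1r ?scale0r.
  by rewrite subrr addbT /tensv tensmx0 addr0.
by rewrite addbF /tensv !tensmx0 subr0 add0r.
Qed.

Lemma flipT_st c i v phi t x :
  flip_mx predT *m st c i v phi t (ket R x) = st (~~ c) i v phi t (ket R x).
Proof. by rewrite flip_st addbT. Qed.

Variables (UC : 'M[C]_(nW * N)) (UB : 'M[C]_dI) (UT : 'M[C]_(tJ * tW)).
Local Notation query := (query_mx a UC UB UT).

Lemma queryB_st inv i v phi t al :
  query OracleB inv *m st true i v phi t al =
  st true (adj_if inv UB *m i) v phi t al.
Proof. by rewrite /query_mx /st controlled_mul tens_tensv mul1mx. Qed.

Lemma queryC_st c i v phi phi' t al :
  UC *m tensv v phi = tensv v phi' ->
  query OracleC false *m st c i v phi t al =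
  st c i v (if c then phi' else phi) t al.
Proof.
move=> h; rewrite /query_mx /st controlled_mul.
by case: c; rewrite // !tens_tensv /= h !mul1mx.
Qed.

Lemma queryT_st inv i v phi t al :
  query OracleT inv *m st true i v phi t al =
  st true i v phi (adj_if inv UT *m t) al.
Proof. by rewrite /query_mx /st controlled_mul !tens_tensv !mul1mx. Qed.

(* Locked, so that unification never executes a circuit. *)
Definition run (c : circuit R D) (phi : 'cV[C]_D) : 'cV[C]_D :=
  locked_with run_key (foldl (fun phi g => gate_mx UC UB UT g *m phi) phi c).

Lemma runE c phi : run c phi = foldl (fun phi g => gate_mx UC UB UT g *m phi) phi c.
Proof. by rewrite /run unlock. Qed.

Lemma run_cat c1 c2 phi : run (c1 ++ c2) phi = run c2 (run c1 phi).
Proof. by rewrite !runE foldl_cat. Qed.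

Lemma run_free U c phi : run (Free U :: c) phi = run c (U *m phi).
Proof. by rewrite !runE. Qed.

Lemma run_query o inv c phi :
  run (Query R D o inv :: c) phi = run c (query o inv *m phi).
Proof. by rewrite !runE. Qed.

Lemma run_nil phi : run [::] phi = phi.
Proof. by rewrite runE. Qed.

Lemma runD c u v : run c (u + v) = run c u + run c v.
Proof.
rewrite !runE; elim: c u v => //= g c IH u v.
by rewrite mulmxDr IH.
Qed.

Lemma runZ c s u : run c (s *: u) = s *: run c u.
Proof.
rewrite !runE; elim: c u => //= g c IH u.
by rewrite -scalemxAr IH.
Qed.

Lemma run_sum c (I : Type) (r : seq I) (F : I -> 'cV[C]_D) :
  run c (\sum_(i <- r) F i) = \sum_(i <- r) run c (F i).
Proof.
apply: (big_morph (run c)); first exact: runD.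
by rewrite -[0 in LHS](scale0r (0 : 'cV[C]_D)) runZ scale0r.
Qed.

End Gates.

(* |i>|0> (index and weight registers) is turned into |i>|w_i> by moving the
   index to the registers of T and the result of the query back. The control
   qubit, which must be set for the query anyway, marks which of the two places
   is in use, so that the moves are reflections exchanging orthogonal
   families. *)
Section Loader.
Variables (R : realType) (dI nw N tJ tW a : nat).
Local Notation C := R[i].
Local Notation D := (regdim dI nw N tJ tW a).
Local Notation nW := (2 ^ nw)%N.
Variables (VJin VJout : 'M[C]_(tJ, dI)) (VWin VWout : 'M[C]_(tW, nW)).
Hypotheses (VJinP : isometry_mx VJin) (VJoutP : isometry_mx VJout).
Hypotheses (VWinP : isometry_mx VWin) (VWoutP : isometry_mx VWout).
Hypotheses (dI0 : (0 < dI)%N) (tJ0 : (0 < tJ)%N) (tW0 : (0 < tW)%N).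

Local Notation t0 := (tensv (ket0 R tJ) (ket0 R tW)).
Local Notation i0 := (ket0 R dI).
Local Notation w0 := (ket0 R nW).

Lemma cdot_t0 : cdot t0 t0 = 1.
Proof. by rewrite cdot_tensv !cdot_ket0 // mulr1. Qed.

Lemma cdot_w0 : cdot w0 w0 = 1.
Proof. by rewrite cdot_ket0 // expn_gt0. Qed.

Lemma cdot_i0 : cdot i0 i0 = 1.
Proof. by rewrite cdot_ket0. Qed.

Definition src_in (x : 'I_dI * 'I_N * 'I_a) : 'cV[C]_D :=
  st false (ket R x.1.1) w0 (ket R x.1.2) t0 (ket R x.2).

Definition dst_in (x : 'I_dI * 'I_N * 'I_a) : 'cV[C]_D :=
  st true i0 w0 (ket R x.1.2)
    (tensv (VJin *m ket R x.1.1) (VWin *m w0)) (ket R x.2).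

Definition src_out (x : 'I_dI * 'I_nW * 'I_N * 'I_a) : 'cV[C]_D :=
  st true i0 w0 (ket R x.1.2)
    (tensv (VJout *m ket R x.1.1.1) (VWout *m ket R x.1.1.2)) (ket R x.2).

Definition dst_out (x : 'I_dI * 'I_nW * 'I_N * 'I_a) : 'cV[C]_D :=
  st false (ket R x.1.1.1) (ket R x.1.1.2) (ket R x.1.2) t0 (ket R x.2).

Definition move_in := swap_mx src_in dst_in.
Definition move_out := swap_mx src_out dst_out.

Lemma src_inO : orthonormal_family src_in.
Proof.
move=> [[i s] x] [[j r] y]; rewrite cdot_st cdot_w0 cdot_t0 !cdot_ket /=.
by rewrite mul1r !mulr1 -!natrM !mulnb -!xpair_eqE.
Qed.

Lemma dst_inO : orthonormal_family dst_in.
Proof.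
move=> [[i s] x] [[j r] y]; rewrite cdot_st cdot_w0 cdot_i0 cdot_tensv.
rewrite !cdot_isometry // cdot_w0 !cdot_ket /=.
by rewrite !mul1r !mulr1 -!natrM !mulnb (andbC (s == r)) -!xpair_eqE.
Qed.

Lemma src_outO : orthonormal_family src_out.
Proof.
move=> [[[i v] s] x] [[[j w] r] y]; rewrite cdot_st cdot_w0 cdot_i0 cdot_tensv.
rewrite !cdot_isometry // !cdot_ket /=.
by rewrite !mul1r -!natrM !mulnb (andbC (s == r)) -!xpair_eqE.
Qed.

Lemma dst_outO : orthonormal_family dst_out.
Proof.
move=> [[[i v] s] x] [[[j w] r] y]; rewrite cdot_st cdot_t0 !cdot_ket /=.
by rewrite !mul1r !mulr1 -!natrM !mulnb -!xpair_eqE.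
Qed.

Lemma src_dst_in x y : cdot (src_in x) (dst_in y) = 0.
Proof. by rewrite cdot_st /= !mul0r. Qed.

Lemma src_dst_out x y : cdot (src_out x) (dst_out y) = 0.
Proof. by rewrite cdot_st /= !mul0r. Qed.

Lemma move_in_unitary : move_in \is unitarymx.
Proof. exact: swap_unitary src_inO dst_inO src_dst_in. Qed.

Lemma move_out_unitary : move_out \is unitarymx.
Proof. exact: swap_unitary src_outO dst_outO src_dst_out. Qed.

Lemma move_inE i phi x :
  move_in *m st false (ket R i) w0 phi t0 (ket R x) =
  st true i0 w0 phi (tensv (VJin *m ket R i) (VWin *m w0)) (ket R x).
Proof.
rewrite (ket_basis phi) !st_sumphi mulmx_sumr; apply: eq_bigr => s _.
rewrite -scalemxAr; congr (_ *: _).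
exact: (swap_mul src_inO src_dst_in (i, s, x)).
Qed.

Lemma move_inV i phi x :
  move_in *m st true i0 w0 phi (tensv (VJin *m ket R i) (VWin *m w0)) (ket R x)
  = st false (ket R i) w0 phi t0 (ket R x).
Proof.
rewrite (ket_basis phi) !st_sumphi mulmx_sumr; apply: eq_bigr => s _.
rewrite -scalemxAr; congr (_ *: _).
exact: (swap_mulV dst_inO src_dst_in (i, s, x)).
Qed.

Lemma move_outE i v phi x :
  move_out *m st true i0 w0 phi (tensv (VJout *m ket R i) (VWout *m ket R v))
    (ket R x) = st false (ket R i) (ket R v) phi t0 (ket R x).
Proof.
rewrite (ket_basis phi) !st_sumphi mulmx_sumr; apply: eq_bigr => s _.
rewrite -scalemxAr; congr (_ *: _).
exact: (swap_mul src_outO src_dst_out (i, v, s, x)).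
Qed.

Lemma move_outV i v phi x :
  move_out *m st false (ket R i) (ket R v) phi t0 (ket R x) =
  st true i0 w0 phi (tensv (VJout *m ket R i) (VWout *m ket R v)) (ket R x).
Proof.
rewrite (ket_basis phi) !st_sumphi mulmx_sumr; apply: eq_bigr => s _.
rewrite -scalemxAr; congr (_ *: _).
exact: (swap_mulV dst_outO src_dst_out (i, v, s, x)).
Qed.

(** While the weight is loaded the control qubit is clear, and flips set it where [p] holds for the
    query to the classifier. The last three gates undo the first three, the moves being
    involutions. *)
Definition select (p : pred 'I_a) (s : 'I_a -> C) : circuit R D :=
  [:: Free move_in; Query _ _ OracleT false; Free move_out;
      Free (flip_mx R dI nw N tJ tW p); Query _ _ OracleC false;
      Free (flip_mx R dI nw N tJ tW p);
      Free (on_work dI nw N tJ tW (diag_mx (\row_x s x)));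
      Free move_out; Query _ _ OracleT true; Free move_in].

(** This is [select] conjugated by B; a query acts only when the control qubit is set, hence the
    unconditional flips. *)
Definition encoding p s : circuit R D :=
  [:: Free (flip_mx R dI nw N tJ tW predT); Query _ _ OracleB false;
      Free (flip_mx R dI nw N tJ tW predT)] ++ select p s ++
  [:: Free (flip_mx R dI nw N tJ tW predT); Query _ _ OracleB true;
      Free (flip_mx R dI nw N tJ tW predT)].

Lemma encoding_valid p s : (forall x, `|s x| = 1) -> valid (encoding p s).
Proof.
move=> s1; have F q := flip_unitary R dI nw N tJ tW q.
have S : on_work dI nw N tJ tW (diag_mx (\row_x s x)) \is unitarymx.
  by apply/on_work_unitary/diag_mx_unitary => x; rewrite mxE.
rewrite /valid /=.
have mi := move_in_unitary; have mo := move_out_unitary.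
apply/and5P; split; [exact: F | exact: F | exact: mi | exact: mo |].
apply/and5P; split; [exact: F | exact: F | exact: S | exact: mo |].
by apply/and3P; split; [exact: mi | exact: F | rewrite andbT; exact: F].
Qed.

Lemma encoding_nqueries p s : nqueries (encoding p s) = 5%N.
Proof. by []. Qed.

Variables (M : nat) (lab : 'I_M -> 'I_dI) (w : 'I_M -> 'I_nW).
Variables (Cl : 'I_nW -> 'M[C]_N).
Variables (UC : 'M[C]_(nW * N)) (UB : 'M[C]_dI) (UT : 'M[C]_(tJ * tW)).
Hypothesis UCP : forall v phi,
  UC *m tensv (ket R v) phi = tensv (ket R v) (Cl v *m phi).
Hypotheses (UBu : UB \is unitarymx) (UTu : UT \is unitarymx).
Hypothesis UTP : forall j, UT *m ((VJin *t VWin) *m tensv (ket R (lab j)) w0) =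
  (VJout *t VWout) *m tensv (ket R (lab j)) (ket R (w j)).

Local Notation run := (run UC UB UT).

(** The index states [UB^t* *m ket R (lab j)] sum to the initial index state with amplitudes
    [sqrt (b j)], and B sends each of them to a basis state, on which [select] is understood. *)
Definition branch j phi x : 'cV[C]_D :=
  st false (UB^t* *m ket R (lab j)) w0 phi t0 (ket R x).

Lemma run_select p s j phi x :
  run (select p s) (st false (ket R (lab j)) w0 phi t0 (ket R x)) =
  s x *: st false (ket R (lab j)) w0 (if p x then Cl (w j) *m phi else phi)
    t0 (ket R x).
Proof.
have stZ phi' : st false (ket R (lab j)) (ket R (w j)) phi' t0 (s x *: ket R x) =
    s x *: st false (ket R (lab j)) (ket R (w j)) phi' t0 (ket R x).
  by rewrite /st !tensvZr.
rewrite /select run_free move_inE run_query queryT_st -tens_tensv UTP tens_tensv.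
rewrite run_free move_outE run_free flip_st run_query (queryC_st _ _ _ _ _ _ (UCP _ _)).
rewrite run_free flip_st run_free on_work_st diag_mx_ket mxE addFb addbb stZ.
rewrite runZ; congr (_ *: _).
(* Uncomputation of the weight: by unitarity, the equation for [UT] read backwards returns the
   registers of T to their state before the first query. *)
rewrite run_free move_outV run_query queryT_st -tens_tensv -UTP mulmxA.
by rewrite unitary_adj_mul // mul1mx tens_tensv run_free move_inV run_nil.
Qed.

Lemma run_conjB c i v phi phi' t (x : 'I_a) s :
  run c (st false (UB *m i) v phi t (ket R x)) =
    s *: st false (UB *m i) v phi' t (ket R x) ->
  run ([:: Free (flip_mx R dI nw N tJ tW predT); Query _ _ OracleB false;
        Free (flip_mx R dI nw N tJ tW predT)] ++ c ++
       [:: Free (flip_mx R dI nw N tJ tW predT); Query _ _ OracleB true;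
        Free (flip_mx R dI nw N tJ tW predT)])
    (st false i v phi t (ket R x)) = s *: st false i v phi' t (ket R x).
Proof.
move=> h; rewrite run_cat run_free flipT_st run_query queryB_st run_free flipT_st.
rewrite run_nil run_cat h runZ; congr (_ *: _).
rewrite run_free flipT_st run_query queryB_st run_free flipT_st run_nil.
by rewrite mulmxA unitary_adj_mul // mul1mx.
Qed.

Lemma run_encoding p s j phi x :
  run (encoding p s) (branch j phi x) =
  s x *: branch j (if p x then Cl (w j) *m phi else phi) x.
Proof.
apply: run_conjB; rewrite mulmxA (unitarymxP UBu) mul1mx; exact: run_select.
Qed.

End Loader.

(** * The quantum walk *)

Lemma tensv_ket (R : realType) m n (i : 'I_m) (j : 'I_n) :
  tensv (ket R i) (ket R j) = ket R (mxtens_index (i, j)).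
Proof.
apply/colP => x; case: (mxtens_indexP x) => k l.
by rewrite tensvE !mxE !andbT -natrM mulnb (can_eq (@mxtens_indexK _ _)).
Qed.

Section WalkCoefficients.
Variable C : numClosedFieldType.
Implicit Types mu nu : C.

(** The coefficient of [g - z s], for [z = mu + i nu], in the rotated start vector
    [s + (i - 1) mu g]. The other eigenvector is obtained by changing the sign of [nu]. *)
Definition in_coef mu nu : C :=
  - (1 + ('i - 1) * mu * (mu - 'i * nu)) / (2 * 'i * nu).

(** The component along g of what the closing phase and encoding make of [g - z s]. *)
Definition out_coef mu (z : C) : C := (z * (1 + 'i) * mu - 'i) * mu - z.

Lemma in_coefE mu nu : mu ^+ 2 + nu ^+ 2 = 1 ->
  in_coef mu nu = - ((mu + nu) * (nu + 'i * mu)) / (2 * 'i * nu).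
Proof.
move=> circ; congr (- _ / _); rewrite -{1}circ.
(* The identity holds modulo ['i ^+ 2 + 1]; the multiple of it is made explicit so that it can be
   cancelled. *)
have -> : mu ^+ 2 + nu ^+ 2 + ('i - 1) * mu * (mu - 'i * nu) =
  (mu + nu) * (nu + 'i * mu) - ('i ^+ 2 + 1) * (mu * nu) by ring.
by rewrite sqrCi addNr mul0r subr0.
Qed.

Lemma out_coefE mu nu : mu ^+ 2 + nu ^+ 2 = 1 ->
  out_coef mu (mu + 'i * nu) = - ((mu + nu) * nu * (mu + 'i * nu)).
Proof.
move=> circ; apply/eqP; rewrite -subr_eq0; apply/eqP.
have -> : out_coef mu (mu + 'i * nu) - - ((mu + nu) * nu * (mu + 'i * nu)) =
  ('i ^+ 2 + 1) * (mu ^+ 2 * nu) +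
  (mu ^+ 2 + nu ^+ 2 - 1) * (mu + 'i * mu + 'i * nu).
  by rewrite /out_coef; ring.
by rewrite sqrCi addNr circ subrr !mul0r addr0.
Qed.

(** This is the total weight with which one eigenvector contributes to the final component along g.
    The two weights, for [nu] and [- nu], add up to 1, and the second is small when [mu] is near
    [1 / sqrt 2]. *)
Lemma in_out_coef mu nu : mu ^+ 2 + nu ^+ 2 = 1 -> nu != 0 ->
  in_coef mu nu * out_coef mu (mu + 'i * nu) = (mu + nu) ^+ 2 / 2.
Proof.
move=> circ nu0; rewrite in_coefE // out_coefE //.
have -> : - ((mu + nu) * (nu + 'i * mu)) / (2 * 'i * nu) *
  - ((mu + nu) * nu * (mu + 'i * nu)) =
  ((mu + nu) ^+ 2 / 2) * (mu ^+ 2 + nu ^+ 2 + (mu * nu / 'i) * ('i ^+ 2 + 1)).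
  by field; rewrite nu0 neq0Ci.
by rewrite sqrCi addNr mulr0 addr0 circ mulr1.
Qed.

(** With the next lemma, these are the equations along g and along s that characterize the
    decomposition of the rotated start vector. *)
Lemma in_coefD mu nu : nu != 0 ->
  in_coef mu nu + in_coef mu (- nu) = ('i - 1) * mu.
Proof. by move=> nu0; rewrite /in_coef; field; rewrite nu0 neq0Ci. Qed.

Lemma in_coef_mulD mu nu : mu ^+ 2 + nu ^+ 2 = 1 -> nu != 0 ->
  in_coef mu nu * (mu + 'i * nu) + in_coef mu (- nu) * (mu - 'i * nu) = -1.
Proof.
by move=> circ nu0; rewrite /in_coef; field; rewrite nu0 neq0Ci.
Qed.

End WalkCoefficients.

Section Walk.
Variables (R : realType) (dI nw N tJ tW n : nat).
Local Notation C := R[i].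
Local Notation a := (3 * n)%N.
Local Notation D := (regdim dI nw N tJ tW a).
Local Notation nW := (2 ^ nw)%N.
Variables (VJin VJout : 'M[C]_(tJ, dI)) (VWin VWout : 'M[C]_(tW, nW)).
Hypotheses (VJinP : isometry_mx VJin) (VJoutP : isometry_mx VJout).
Hypotheses (VWinP : isometry_mx VWin) (VWoutP : isometry_mx VWout).
Hypotheses (dI0 : (0 < dI)%N) (tJ0 : (0 < tJ)%N) (tW0 : (0 < tW)%N).
Variable wt : 'I_3 -> R.
Hypotheses (wt0 : forall q, 0 <= wt q) (wt1 : \sum_q wt q = 1).

Local Notation t0 := (tensv (ket0 R tJ) (ket0 R tW)).
Local Notation i0 := (ket0 R dI).
Local Notation w0 := (ket0 R nW).
Local Notation q1 := (Ordinal (isT : 1 < 3)%N).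
Local Notation q2 := (Ordinal (isT : 2 < 3)%N).

Definition amp : 'cV[C]_3 := \col_q (Num.sqrt (wt q))%:C%C.

Definition active (j : nat) (x : 'I_a) := (j <= (mxtens_unindex x).2)%N.

(* Branches 0, 1 and 2 of the ancilla apply 1, C and -1; the j-th step of the
   walk acts on |k> only when j <= k, so that |k> undergoes k steps. *)
Definition enc (j : nat) : circuit R D :=
  encoding N VJin VJout VWin VWout
    (fun x => ((mxtens_unindex x).1 == q1) && active j x)
    (fun x => if ((mxtens_unindex x).1 == q2) && active j x then -1 else 1).

Definition good (k : 'I_n) (phi : 'cV[C]_N) : 'cV[C]_D :=
  st false i0 w0 phi t0 (tensv amp (ket R k)).

Definition good_fam (x : 'I_n * 'I_N) : 'cV[C]_D := good x.1 (ket R x.2).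

Lemma amp_real q : (amp q 0)^* = amp q 0.
Proof. by rewrite mxE; apply/CrealP/complex_realP; eexists. Qed.

Lemma amp_sqr q : amp q 0 * amp q 0 = (wt q)%:C%C.
Proof. by rewrite mxE -rmorphM /= -expr2 sqr_sqrtr. Qed.

Lemma amp_unit : cdot amp amp = 1.
Proof.
rewrite cdotE (eq_bigr (fun q => (wt q)%:C%C)) -?rmorph_sum ?wt1 // => q _.
by rewrite amp_real amp_sqr.
Qed.

Lemma good_famO : orthonormal_family good_fam.
Proof.
move=> [k s] [l r]; rewrite /good_fam /good cdot_st cdot_i0 // cdot_w0 cdot_t0 //.
by rewrite cdot_tensv amp_unit !cdot_ket /= !(mulr1, mul1r) -natrM mulnb andbC.
Qed.

Definition phase (f : 'I_n -> C) : gate R D :=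
  Free (phase_mx good_fam (fun x => f x.1)).

Definition walk (m : nat) : circuit R D :=
  flatten [seq enc j ++ [:: phase (fun k => if (j <= k)%N then -1 else 1)]
          | j <- iota 1 m].

(** Step 0 is active on every [|k>]: it makes s out of g, and the phase ['i] on the component along
    g brings the result close to a single eigenvector of the walk. The last two pieces undo this
    rotation; [n.-1] steps are enough since [k < n]. *)
Definition core : circuit R D :=
  enc 0 ++ [:: phase (fun=> 'i)] ++ walk n.-1 ++ [:: phase (fun=> - 'i)] ++ enc 0.

Lemma enc_valid j : valid (enc j).
Proof.
by apply: encoding_valid => // x; case: ifP; rewrite ?normrN normr1.
Qed.

Lemma phase_valid f : (forall k, `|f k| = 1) -> valid [:: phase f].
Proof.
move=> f1; rewrite /valid /= andbT; apply: phase_unitary => //.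
exact: good_famO.
Qed.

Lemma valid_cat T (c1 c2 : circuit R T) : valid (c1 ++ c2) = valid c1 && valid c2.
Proof. exact: all_cat. Qed.

Lemma nqueries_cat T (c1 c2 : circuit R T) :
  nqueries (c1 ++ c2) = (nqueries c1 + nqueries c2)%N.
Proof. exact: count_cat. Qed.

Lemma walkS m : walk m.+1 =
  walk m ++ enc m.+1 ++ [:: phase (fun k => if (m < k)%N then -1 else 1)].
Proof.
have e : iota 1 m.+1 = iota 1 m ++ [:: m.+1] by rewrite -{1}[m.+1]addn1 iotaD add1n.
rewrite /walk e map_cat flatten_cat; congr (_ ++ _); exact: cats0.
Qed.

Lemma walk_valid m : valid (walk m).
Proof.
elim: m => [|m IH]; first by rewrite /valid.
rewrite walkS valid_cat; apply/andP; split; first exact: IH.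
rewrite valid_cat; apply/andP; split; first exact: enc_valid.
by apply: phase_valid => k; case: ifP; rewrite ?normrN normr1.
Qed.

Lemma core_valid : valid core.
Proof.
rewrite /core valid_cat; apply/andP; split; first exact: enc_valid.
rewrite valid_cat; apply/andP; split.
  by apply: phase_valid => k; rewrite normCi.
rewrite valid_cat; apply/andP; split; first exact: walk_valid.
rewrite valid_cat; apply/andP; split; last exact: enc_valid.
by apply: phase_valid => k; rewrite normrN normCi.
Qed.

Lemma walk_nqueries m : nqueries (walk m) = (5 * m)%N.
Proof.
elim: m => [|m IH]; first exact: erefl.
by rewrite walkS !nqueries_cat IH mulnS addnC.
Qed.

Lemma core_nqueries : nqueries core = (5 * n.-1 + 10)%N.
Proof.
have cat5 (c1 c2 c3 c4 c5 : circuit R D) :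
    nqueries (c1 ++ c2 ++ c3 ++ c4 ++ c5) =
    (nqueries c1 + (nqueries c2 + (nqueries c3 + (nqueries c4 + nqueries c5))))%N.
  by rewrite !nqueries_cat.
have nenc : nqueries (enc 0) = 5%N by exact: encoding_nqueries.
have nphase f : nqueries [:: phase f] = 0%N by [].
have add m x p q : x = 5%N -> p = 0%N -> q = 0%N ->
    (x + (p + (m + (q + x))) = m + 10)%N.
  by move=> -> -> ->; rewrite !add0n addnCA.
by rewrite /core cat5 walk_nqueries; apply: add nenc (nphase _) (nphase _).
Qed.

Variables (M : nat) (lab : 'I_M -> 'I_dI) (w : 'I_M -> 'I_nW) (b : 'I_M -> R).
Variables (Cl : 'I_nW -> 'M[C]_N).
Variables (UC : 'M[C]_(nW * N)) (UB : 'M[C]_dI) (UT : 'M[C]_(tJ * tW)).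
Hypothesis lab_inj : injective lab.
Hypotheses (b0 : forall j, 0 <= b j) (b1 : \sum_j b j = 1).
Hypothesis ClV : forall j, Cl (w j) *m Cl (w j) = 1%:M.
Hypothesis UCP : forall v phi,
  UC *m tensv (ket R v) phi = tensv (ket R v) (Cl v *m phi).
Hypotheses (UBu : UB \is unitarymx) (UTu : UT \is unitarymx).
Hypothesis UBP : UB *m i0 = \sum_j (Num.sqrt (b j))%:C%C *: ket R (lab j).
Hypothesis UTP : forall j, UT *m ((VJin *t VWin) *m tensv (ket R (lab j)) w0) =
  (VJout *t VWout) *m tensv (ket R (lab j)) (ket R (w j)).

Local Notation run := (run UC UB UT).
Local Notation A := (\sum_j (b j)%:C%C *: Cl (w j)).
Local Notation branch := (@branch R dI nw N tJ tW a M lab UB).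
Local Notation sb j := ((Num.sqrt (b j))%:C%C : C).

Lemma i0E : i0 = \sum_j sb j *: (UB^t* *m ket R (lab j)).
Proof.
rewrite -[LHS]mul1mx -(unitary_adj_mul UBu) -mulmxA UBP mulmx_sumr.
by apply: eq_bigr => j _; rewrite -scalemxAr.
Qed.

Lemma cdot_i0_branch j : cdot i0 (UB^t* *m ket R (lab j)) = sb j.
Proof.
rewrite cdot_adj trmxCK UBP cdot_suml (bigD1 j) //= big1 ?addr0.
  rewrite cdotZl cdot_ket eqxx mulr1.
  by apply/CrealP/complex_realP; eexists.
by move=> k kj; rewrite cdotZl cdot_ket (inj_eq lab_inj) (negPf kj) mulr0.
Qed.

(** The vector [s = S g], with g being [good k phi], expanded over the branches. *)
Definition flagged (k : 'I_n) (phi : 'cV[C]_N) : 'cV[C]_D :=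
  \sum_q \sum_j (amp q 0 * (if q == q2 then -1 else 1) * sb j) *:
    branch j (if q == q1 then Cl (w j) *m phi else phi) (mxtens_index (q, k)).

Lemma goodE k phi : good k phi =
  \sum_q \sum_j (amp q 0 * sb j) *: branch j phi (mxtens_index (q, k)).
Proof.
rewrite /good {1}(ket_basis amp) tensv_suml.
rewrite (eq_bigr (fun q => amp q 0 *: ket R (mxtens_index (q, k)))); last first.
  by move=> q _; rewrite tensvZl tensv_ket.
rewrite st_sumal; apply: eq_bigr => q _.
rewrite i0E st_sumi scaler_sumr; apply: eq_bigr => j _.
by rewrite scalerA.
Qed.

Lemma run_enc_branch j i phi q k :
  run (enc j) (branch i phi (mxtens_index (q, k))) =
  (if (q == q2) && (j <= k)%N then -1 else 1) *:
    branch i (if (q == q1) && (j <= k)%N then Cl (w i) *m phi else phi)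
      (mxtens_index (q, k)).
Proof.
rewrite /enc (@run_encoding _ _ _ _ _ _ a _ _ _ _ VJinP VJoutP VWinP VWoutP
  dI0 tJ0 tW0 _ _ _ _ _ _ _ UCP UBu UTu UTP).
by rewrite /active mxtens_indexK.
Qed.

Lemma run_enc_good j k phi :
  run (enc j) (good k phi) = if (j <= k)%N then flagged k phi else good k phi.
Proof.
rewrite goodE /flagged run_sum; case: leqP => jk; apply: eq_bigr => q _.
  rewrite run_sum; apply: eq_bigr => i _.
  by rewrite runZ run_enc_branch jk !andbT scalerA mulrAC.
rewrite run_sum; apply: eq_bigr => i _.
by rewrite runZ run_enc_branch leqNgt jk !andbF scale1r.
Qed.

(** The signs and the classifiers square to 1, so S maps s back to g. *)
Lemma run_enc_flagged j k phi :
  run (enc j) (flagged k phi) = if (j <= k)%N then good k phi else flagged k phi.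
Proof.
rewrite goodE /flagged run_sum; case: leqP => jk; apply: eq_bigr => q _.
  rewrite run_sum; apply: eq_bigr => i _.
  rewrite runZ run_enc_branch jk !andbT scalerA; congr (_ *: branch _ _ _).
    by case: (q == q2); ring.
  by case: (q == q1) => //; rewrite mulmxA ClV mul1mx.
rewrite run_sum; apply: eq_bigr => i _.
by rewrite runZ run_enc_branch leqNgt jk !andbF scale1r.
Qed.

Lemma cdot_good k s l phi : cdot (good_fam (k, s)) (good l phi) = (k == l)%:R * phi s 0.
Proof.
rewrite /good_fam /good cdot_st cdot_i0 // cdot_w0 cdot_t0 // cdot_tensv amp_unit.
by rewrite cdot_ket cdot_ketl /= !(mulr1, mul1r) mulrC.
Qed.

Lemma cdot_branch k s j phi q l :
  cdot (good_fam (k, s)) (branch j phi (mxtens_index (q, l))) =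
  sb j * phi s 0 * amp q 0 * (k == l)%:R.
Proof.
rewrite /good_fam /good cdot_st cdot_i0_branch cdot_w0 cdot_t0 // -tensv_ket.
rewrite cdot_tensv cdot_ket cdot_ketl (cdotC amp) cdot_ketl amp_real /=.
by rewrite !(mulr1, mul1r) mulrA.
Qed.

Variables (l : C) (phi : 'cV[C]_N).
Hypothesis phiE : A *m phi = l *: phi.
Let mu : C := (wt ord0)%:C%C - (wt q2)%:C%C + (wt q1)%:C%C * l.

(** This is [G^* S G = mu]. Each branch enters with the square of its amplitude, so the classifiers
    are averaged to [A], which acts on [phi] as [l], and the ancilla weighs [1], [A] and [-1] by
    [wt]. *)
Lemma cdot_flagged k s k' :
  cdot (good_fam (k, s)) (flagged k' phi) = (k == k')%:R * (mu * phi s 0).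
Proof.
have b1C : \sum_j (b j)%:C%C = 1 :> C by rewrite -rmorph_sum b1.
rewrite cdot_sum.
rewrite (eq_bigr (fun q => (k == k')%:R * ((wt q)%:C%C * (if q == q2 then -1 else 1)
   * (if q == q1 then l else 1) * phi s 0))); last first.
  move=> q _; rewrite cdot_sum.
  rewrite (eq_bigr (fun j =>
    (k == k')%:R * ((wt q)%:C%C * (if q == q2 then -1 else 1)) *
    ((b j)%:C%C * (if q == q1 then (Cl (w j) *m phi) s 0 else phi s 0)))).
    rewrite -mulr_sumr -!mulrA; do 3!congr (_ * _).
    case: (q == q1); last by rewrite -mulr_suml b1C.
    have := congr1 (fun v : 'cV_N => v s 0) phiE.
    rewrite mulmx_suml summxE !mxE => <-; apply: eq_bigr => j _.
    by rewrite -scalemxAl [RHS]mxE.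
  move=> j _; rewrite cdotZ cdot_branch -amp_sqr.
  have -> : (b j)%:C%C = sb j * sb j by rewrite -rmorphM /= -expr2 sqr_sqrtr.
  have perm x e y c d : x * e * y * (y * c * x * d) =
      d * (x * x * e) * (y * y * c) :> C by ring.
  by case: (q == q1); exact: perm.
rewrite -mulr_sumr -mulr_suml; congr (_ * (_ * _)).
have e1 : lift ord0 ord0 = q1 by apply: val_inj.
have e2 : lift ord0 (lift ord0 ord0) = q2 by apply: val_inj.
rewrite /mu 3!big_ord_recl big_ord0 e2 e1 !mulr1 mulrN1 addr0.
by rewrite (addrC (_ * l)) addrA.
Qed.

Lemma sum_good_fam (f : 'I_n -> C) (m : C) k :
  \sum_x (f x.1 * ((x.1 == k)%:R * (m * phi x.2 0))) *: good_fam x =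
  (f k * m) *: good k phi.
Proof.
rewrite -(pair_bigA _ (fun k' s => (f k' * ((k' == k)%:R * (m * phi s 0))) *:
  good_fam (k', s))) /= (bigD1 k) //= [X in _ + X]big1 ?addr0; last first.
  move=> k' /negPf kk; rewrite big1 // => s _.
  by rewrite kk mul0r mulr0 scale0r.
rewrite [in RHS]/good [in RHS](ket_basis phi) st_sumphi scaler_sumr.
apply: eq_bigr => s _.
by rewrite eqxx mul1r scalerA mulrA.
Qed.

Lemma run_phase_good f k : run [:: phase f] (good k phi) = f k *: good k phi.
Proof.
rewrite run_free run_nil phase_mulE (eq_bigr (fun x =>
  ((f x.1 - 1) * ((x.1 == k)%:R * (1 * phi x.2 0))) *: good_fam x)); last first.
  by move=> [k' s] _; rewrite cdot_good mul1r.
rewrite (sum_good_fam (fun k => f k - 1)) mulr1.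
by rewrite -{1}[good k phi]scale1r -scalerDl addrC subrK.
Qed.

Lemma run_phase_flagged f k : run [:: phase f] (flagged k phi) =
  flagged k phi + ((f k - 1) * mu) *: good k phi.
Proof.
rewrite run_free run_nil phase_mulE (eq_bigr (fun x =>
  ((f x.1 - 1) * ((x.1 == k)%:R * (mu * phi x.2 0))) *: good_fam x)); last first.
  by move=> [k' s] _; rewrite cdot_flagged.
by rewrite (sum_good_fam (fun k => f k - 1)).
Qed.

Definition walk_eigen (z : C) k : 'cV[C]_D := good k phi - z *: flagged k phi.

(** An active step first turns [g - z s] into [s - z g]. The reflection maps g to [- g] and s to
    [s - 2 mu g], which yields [s - z' g], that is [- z' (g - z s)]. Inactive steps fix the vector,
    whence the minimum. *)
Lemma run_walk z z' m k : z * z' = 1 -> z + z' = 2 * mu ->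
  run (walk m) (walk_eigen z k) = (- z') ^+ minn k m *: walk_eigen z k.
Proof.
move=> zz zD; elim: m => [|m IH]; first by rewrite minn0 expr0 scale1r [LHS]run_nil.
rewrite walkS run_cat IH runZ run_cat /walk_eigen.
rewrite -scaleNr runD runZ run_enc_good run_enc_flagged.
have [mk|km] : (m < k)%N \/ (k <= m)%N by case: ltnP; [left | right].
  rewrite (minn_idPr (ltnW mk)) (minn_idPr mk) mk runD runZ.
  rewrite run_phase_flagged run_phase_good mk exprSr -[RHS]scalerA; congr (_ *: _).
  rewrite scalerDr !scalerA !mulrNN mulr1 (mulrC z') zz scale1r.
  rewrite -addrA -scalerDl addrC; congr (_ *: _ + _).
  have sum2 (x y m2 : C) : x + y = 2 * m2 -> (- 1 - 1) * m2 + x = - y.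
    move=> e; have -> : x = 2 * m2 - y by rewrite -e addrK.
    ring.
  exact: sum2.
have mk : (m < k)%N = false by rewrite ltnNge km.
rewrite (minn_idPl km) (minn_idPl (leqW km)) mk runD runZ.
by rewrite run_phase_flagged run_phase_good mk subrr mul0r scale0r addr0 scale1r.
Qed.

(** The rotated start vector is split by [in_coef], each part picks up a power of its eigenvalue in
    the walk, and [out_coef] reads the component along g. Components outside the good vectors need
    no computation, as only a lower bound on success is sought. *)
Lemma run_core (nu : C) k k' s :
  mu ^+ 2 + nu ^+ 2 = 1 -> nu != 0 ->
  cdot (good_fam (k', s)) (run core (good k phi)) =
  (k' == k)%:R * (((mu + nu) ^+ 2 / 2 * (- (mu - 'i * nu)) ^+ k
                 + (mu - nu) ^+ 2 / 2 * (- (mu + 'i * nu)) ^+ k) * phi s 0).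
Proof.
move=> circ nu0; set z := mu + 'i * nu; set z' := mu - 'i * nu.
have circN : mu ^+ 2 + (- nu) ^+ 2 = 1 by rewrite sqrrN.
have zz : z * z' = 1.
  by rewrite mulrC -subr_sqr exprMn sqrCi mulN1r opprK.
have zD : z + z' = 2 * mu by rewrite /z addrACA subrr addr0 mulr_natl mulr2n.
have kn : minn k n.-1 = k.
  by apply/minn_idPl; case: (n) k => [[] //|m] k; rewrite -ltnS ltn_ord.
have start : flagged k phi + (('i - 1) * mu) *: good k phi =
    in_coef mu nu *: walk_eigen z k + in_coef mu (- nu) *: walk_eigen z' k.
  rewrite /walk_eigen !scalerBr !scalerA addrACA -scalerDl in_coefD //.
  by rewrite -opprD -scalerDl in_coef_mulD // scaleN1r opprK addrC.
have tail x : cdot (good_fam (k', s))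
    (run ([:: phase (fun=> - 'i)] ++ enc 0) (walk_eigen x k)) =
    (k' == k)%:R * (out_coef mu x * phi s 0).
  rewrite run_cat /walk_eigen -scaleNr runD runZ run_phase_good run_phase_flagged.
  rewrite scalerDr !runD !runZ run_enc_good run_enc_flagged leq0n.
  rewrite !(cdotD, cdotZ) cdot_good cdot_flagged.
  have factor (d m p : C) : - 'i * (d * (m * p)) +
      (- x * (d * p) + - x * ((- 'i - 1) * m * (d * (m * p)))) =
      d * (out_coef m x * p) by rewrite /out_coef; ring.
  exact: factor.
rewrite /core run_cat run_enc_good leq0n run_cat run_phase_flagged start.
rewrite run_cat runD !runZ (run_walk _ _ zz zD) (run_walk _ _ (z := z') (z' := z)).
- have lin c (v u u' : 'cV[C]_D) (e e' d d' : C) :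
      cdot v (run c (e *: (d *: u) + e' *: (d' *: u'))) =
      e * d * cdot v (run c u) + e' * d' * cdot v (run c u').
    by rewrite runD !runZ cdotD !cdotZ !mulrA.
  have subst (x y x' y' p q : C) : x = x' -> y = y' ->
      p * x + q * y = p * x' + q * y' by move=> -> ->.
  rewrite kn lin (subst _ _ _ _ _ _ (tail z) (tail z')).
  rewrite -(in_out_coef circ nu0) -/z.
  have := in_out_coef circN; rewrite oppr_eq0 mulrN -/z' => /(_ nu0) <-.
  have factor (c c' e e' p p' d q : C) :
      c * p * (d * (e * q)) + c' * p' * (d * (e' * q)) =
      d * ((c * e * p + c' * e' * p') * q) by ring.
  exact: factor.
- by rewrite mulrC.
- by rewrite addrC.
Qed.

End Walk.

(** * The final measurement *)

(** [X] is the wanted amplitude vector and [Y] the contribution of the unwanted eigenvector, with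
    small weight [r2]. Interference can cost only a multiple of [r2]. *)
Lemma mixture_bound (C : numClosedFieldType) n (X Y : 'cV[C]_n)
    (near : pred 'I_n) (r1 r2 f : C) :
  0 <= r2 -> r1 + r2 = 1 -> r2 <= r1 -> r1 \is Num.real ->
  cdot X X = 1 -> cdot Y Y = 1 ->
  \sum_(y | ~~ near y) `|X y 0| ^+ 2 <= f ->
  1 - (4%:R * r2 + f) <= \sum_(y | near y) `|(r1 *: X + r2 *: Y) y 0| ^+ 2.
Proof.
move=> r20 r1D r12 r1r X1 Y1 Xf.
have r2r := ger0_real r20.
have r1E : r1 = 1 - r2 by rewrite -r1D addrK.
have f0 : 0 <= f.
  by apply: le_trans Xf; apply: sumr_ge0 => y _; rewrite exprn_ge0.
have r10 : 0 <= r1 := le_trans r20 r12.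
(* The difference of the two sides is [r1 * r2 * |x + y|^2]. *)
have key x y : (r1 - r2) * (r1 * `|x| ^+ 2 - r2 * `|y| ^+ 2) <=
    `|r1 * x + r2 * y| ^+ 2.
  rewrite -subr_ge0 [X in 0 <= X](_ : _ = r1 * r2 * `|x + y| ^+ 2).
    by rewrite !mulr_ge0 ?exprn_ge0.
  rewrite !normCK !(rmorphD, rmorphM) /= (CrealP r1r) (CrealP r2r).
  by rewrite /=; ring.
apply: (@le_trans _ _ (\sum_(y | near y) (r1 - r2) *
    (r1 * `|X y 0| ^+ 2 - r2 * `|Y y 0| ^+ 2))); last first.
  by apply: ler_sum => y _; rewrite !mxE key.
rewrite -mulr_sumr sumrB -!mulr_sumr.
have SX : 1 - f <= \sum_(y | near y) `|X y 0| ^+ 2.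
  rewrite lerBlDr -X1 cdot_normE (bigID near) /= lerD2l; exact: Xf.
have SY : \sum_(y | near y) `|Y y 0| ^+ 2 <= 1.
  rewrite -Y1 cdot_normE [leRHS](bigID near) /= lerDl.
  by apply: sumr_ge0 => y _; rewrite exprn_ge0.
apply: (@le_trans _ _ ((r1 - r2) * (r1 * (1 - f) - r2 * 1))); last first.
  by rewrite ler_wpM2l ?subr_ge0 // lerB // ler_wpM2l.
rewrite r1E -subr_ge0.
have -> : (1 - r2 - r2) * ((1 - r2) * (1 - f) - r2 * 1) - (1 - (4%:R * r2 + f)) =
  4%:R * r2 ^+ 2 + f * r2 * (3%:R - 2%:R * r2) by ring.
have r21 : r2 <= 1 by rewrite -r1D lerDr.
rewrite addr_ge0 ?mulr_ge0 ?exprn_ge0 ?ler0n // subr_ge0.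
apply: (@le_trans _ _ (2%:R * 1)); first by rewrite ler_wpM2l ?ler0n.
by rewrite mulr1 ler_nat.
Qed.

Section Measurement.
Variables (R : realType) (dI nw N tJ tW n : nat).
Local Notation C := R[i].
Local Notation a := (3 * n)%N.
Local Notation D := (regdim dI nw N tJ tW a).
Hypotheses (dI0 : (0 < dI)%N) (tJ0 : (0 < tJ)%N) (tW0 : (0 < tW)%N).
Variable wt : 'I_3 -> R.
Hypotheses (wt0 : forall q, 0 <= wt q) (wt1 : \sum_q wt q = 1).
Local Notation good := (@good R dI nw N tJ tW n wt).
Local Notation good_fam := (@good_fam R dI nw N tJ tW n wt).

Lemma rank1proj_adj (v : 'cV[C]_N) : (rank1proj v)^t* = rank1proj v.
Proof.
rewrite /rank1proj linearZ /= map_mxZ /= -/(outer v) adj_outer; congr (_ *: _).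
by apply/CrealP; rewrite realV ger0_real // cdot_ge0.
Qed.

Lemma rank1proj_mul (v u : 'cV[C]_N) :
  rank1proj v *m u = ((cdot v v)^-1 * cdot v u) *: v.
Proof. by rewrite /rank1proj -scalemxAl -/(outer v) outer_mul scalerA. Qed.

Lemma rank1proj_orth (v u : 'cV[C]_N) : cdot v u = 0 -> rank1proj v *m u = 0.
Proof. by move=> vu; rewrite rank1proj_mul vu mulr0 scale0r. Qed.

Lemma rank1proj_id (v : 'cV[C]_N) : rank1proj v *m v = v.
Proof.
rewrite rank1proj_mul; have [->|v0] := eqVneq v 0; first by rewrite scaler0.
by rewrite mulVf ?scale1r // cdot_eq0.
Qed.

Lemma rank1proj_idem (v : 'cV[C]_N) : rank1proj v *m rank1proj v = rank1proj v.
Proof.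
by rewrite {2}/rank1proj -scalemxAr mulmxA rank1proj_id.
Qed.

Variables (A : 'M[C]_N) (est : 'I_a -> R) (est' : 'I_n -> R) (eps : R).
Variables (psi : 'cV[C]_N).
Hypothesis estE : forall x, est x = est' (mxtens_unindex x).2.
Hypothesis Ah : A \is hermsymmx.

Local Notation effect := (@good_effect R dI nw N tJ tW a A est eps psi).
Local Notation near l := (fun y => `|l - (est' y)%:C%C| <= eps%:C%C).

Lemma effect_st l c i v phi t y :
  effect l *m st c i v phi t (tensv (amp wt) (ket R y)) =
  (near l y)%:R *:
    st c i v (rank1proj (eigproj A l psi) *m phi) t (tensv (amp wt) (ket R y)).
Proof.
rewrite /good_effect /st !tens_tensv !mul1mx.
have -> : diag_mx (\row_y (`|l - (est y)%:C%C| <= eps%:C%C)%R%:R) *m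
    tensv (amp wt) (ket R y) = (near l y)%:R *: tensv (amp wt) (ket R y).
  rewrite mul_diag_mx; apply/colP => x; rewrite mxE mxE [RHS]mxE.
  case: (mxtens_indexP x) => q k; rewrite tensvE estE mxtens_indexK /=.
  rewrite [ket R y _ _]mxE andbT.
  by have [->|_] := eqVneq k y; rewrite // !mulr0.
by rewrite !tensvZr.
Qed.

Lemma effect_adj l : (effect l)^t* = effect l.
Proof.
rewrite /good_effect 5!tens_adj !trmx1 !map_mx1 rank1proj_adj tr_diag_mx map_diag_mx.
set d := map_mx _ _; set d' := \row__ _; rewrite (_ : d = d') //.
by apply/rowP => x; rewrite !mxE rmorph_nat.
Qed.

Lemma effect_idem l : effect l *m effect l = effect l.
Proof.
rewrite /good_effect 5!tensmx_mul !mulmx1 rank1proj_idem mulmx_diag.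
set d := \row_i _; set d' := \row__ _; rewrite (_ : d = d') //.
by apply/rowP => x; rewrite !mxE -natrM mulnb andbb.
Qed.

(** The effect is an orthogonal projection, so its expectation is a squared norm, to which [bessel]
    applies. *)
Lemma expval_effect l (Phi : 'cV[C]_D) :
  expval (effect l) Phi = cdot (effect l *m Phi) (effect l *m Phi).
Proof.
by rewrite cdot_adj effect_adj mulmxA effect_idem /cdot /expval trmx_mul
  map_mxM /= effect_adj.
Qed.

(** By [bessel] it is enough to look at the components of the projected state along [good_fam]. The
    effect is moved across the inner product, where its rank-one factor kills every eigencomponent
    of [psi] but the one for [l]. *)
Lemma success_bound (Phi : 'cV[C]_D) (chi : C -> 'cV[C]_n) :
  (forall y s, cdot (good_fam (y, s)) Phi =
     \sum_(l <- eigvals A) chi l y 0 * eigproj A l psi s 0) ->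
  \sum_(l <- eigvals A) cdot (eigproj A l psi) (eigproj A l psi) *
     (\sum_(y | near l y) `|chi l y 0| ^+ 2) <=
  \sum_(l <- eigvals A) expval (effect l) Phi.
Proof.
move=> PhiE; rewrite !big_seq; apply: ler_sum => l lA.
rewrite expval_effect.
apply: (le_trans _ (bessel (effect l *m Phi)
  (@good_famO R dI nw N tJ tW n dI0 tJ0 tW0 wt wt0 wt1))).
have goodPhi y phi : cdot (good y phi) Phi =
    \sum_(m <- eigvals A) chi m y 0 * cdot phi (eigproj A m psi).
  rewrite /good (ket_basis phi) st_sumphi cdot_suml.
  rewrite (eq_bigr (fun s => \sum_(m <- eigvals A)
    chi m y 0 * ((phi s 0)^* * eigproj A m psi s 0))).
    rewrite exchange_big /=; apply: eq_bigr => m _; rewrite -mulr_sumr.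
    by rewrite -ket_basis cdotE.
  move=> s _; rewrite cdotZl -/(good_fam (y, s)) PhiE mulr_sumr.
  by apply: eq_bigr => m _; rewrite mulrCA.
rewrite [leRHS](eq_bigr (fun x => (near l x.1)%:R *
    (`|chi l x.1 0| ^+ 2 * `|eigproj A l psi x.2 0| ^+ 2))).
  rewrite -(pair_bigA _ (fun y s => (near l y)%:R *
    (`|chi l y 0| ^+ 2 * `|eigproj A l psi s 0| ^+ 2))) /=.
  rewrite big_mkcond mulr_sumr /=; apply: ler_sum => y _.
  rewrite -!mulr_sumr cdot_normE.
  by case: (near l y); rewrite ?mul1r ?mul0r ?mulr0 // mulrC.
move=> [y s] _; rewrite cdot_adj effect_adj /good_fam /good effect_st cdotZl.
have VE u : cdot (rank1proj (eigproj A l psi) *m ket R s) u =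
    (rank1proj (eigproj A l psi) *m u) s 0.
  by rewrite -{1}rank1proj_adj -cdot_adj cdot_ketl.
rewrite conjC_nat -/(good y _) goodPhi (bigD1_seq l) ?undup_uniq //= big1.
  rewrite addr0 VE rank1proj_id !normrM !exprMn normr_nat.
  by case: (near l y); rewrite ?expr1n ?expr0n ?mul0r ?mul1r.
move=> m ml; rewrite VE rank1proj_orth ?mxE ?mulr0 //.
by apply: eigproj_orth ml => //; exact: eigvals_real lA.
Qed.

End Measurement.

(** * Accuracy of the estimate *)

Lemma mulmx_lin2 (C : numClosedFieldType) m n (P : 'M[C]_(m, n)) (r s : C) X Y :
  P *m (r *: X + s *: Y) = r *: (P *m X) + s *: (P *m Y) :> 'cV_m.
Proof. by rewrite mulmxDr -!scalemxAr. Qed.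

Section Detection.
Variable R : realType.
Local Notation C := R[i].
Local Notation l0 := (Num.sqrt (1 / 2) : R).

Definition encoded (kap l : R) : R := l0 + kap * l.

Lemma sqr_l0 : l0 ^+ 2 = 1 / 2.
Proof. by rewrite sqr_sqrtr // divr_ge0 ?ler0n. Qed.

Lemma l0_bounds : 7 / 10 <= l0 <= 3 / 4.
Proof.
have l0_ge0 : 0 <= l0 by exact: sqrtr_ge0.
have := sqr_l0; rewrite expr2 => ?; apply/andP; split; nra.
Qed.

(** On the unit circle [(mu - nu)^2 (mu + nu)^2 = (2 mu^2 - 1)^2], which is [4 (kap l (mu + l0))^2]
    because [l0^2 = 1/2]. As [mu + l0 <= 2] and [(mu + nu)^2 >= 1], this gives
    [(mu - nu)^2 <= 16 kap^2]. *)
Lemma encoded_bounds (kap l : R) : 0 <= kap <= 1 / 8 -> `|l| <= 1 ->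
  let mu := encoded kap l in let nu := Num.sqrt (1 - mu ^+ 2) in
  [/\ 0 < nu, mu ^+ 2 + nu ^+ 2 = 1, 0 <= mu &
      (mu - nu) ^+ 2 / 2 <= 8 * kap ^+ 2].
Proof.
move=> /andP[kap0 kap8] /ler_normlP[l1 l1'] mu nu.
have /andP[l0l l0u] := l0_bounds.
have kl : - kap <= kap * l <= kap by apply/andP; split; nra.
have /andP[mul muu] : 1 / 2 <= mu <= 9 / 10.
  by rewrite /mu /encoded; move: kl => /andP[]; lra.
have nu2 : nu ^+ 2 = 1 - mu ^+ 2 by rewrite sqr_sqrtr // expr2; nra.
have nu0 : 0 < nu by rewrite sqrtr_gt0 expr2; nra.
have circ : mu ^+ 2 + nu ^+ 2 = 1 by rewrite nu2 addrC subrK.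
split=> //; first lra.
have e1 : (mu - nu) ^+ 2 * (mu + nu) ^+ 2 = 4 * ((kap * l) * (mu + l0)) ^+ 2.
  have -> : (kap * l) * (mu + l0) = mu ^+ 2 - l0 ^+ 2.
    by rewrite subr_sqr; congr (_ * _); rewrite /mu /encoded addrAC subrr add0r.
  rewrite -exprMn -subr_sqr nu2 sqr_l0.
  have gen (x : R) : (x - (1 - x)) ^+ 2 = 4 * (x - 1 / 2) ^+ 2 by field.
  exact: gen.
have e2 : 1 <= (mu + nu) ^+ 2 by rewrite sqrrD -addrAC circ lerDl; nra.
have e3 : ((kap * l) * (mu + l0)) ^+ 2 <= kap ^+ 2 * 4.
  have /andP[k1 k2] := kl.
  rewrite exprMn; apply: ler_pM; rewrite ?sqr_ge0 // !expr2; last by nra.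
  by nra.
have e4 : (mu - nu) ^+ 2 <= (mu - nu) ^+ 2 * (mu + nu) ^+ 2.
  by rewrite ler_peMr ?sqr_ge0.
by move: e4; rewrite e1 => e4; lra.
Qed.

Lemma normc_real (x : R) : `|x%:C%C| = `|x|%:C%C.
Proof. by rewrite normc_def /= expr0n /= addr0 sqrtr_sqr. Qed.

Lemma half_sqr_real (x : R) : x%:C%C ^+ 2 / 2 = (x ^+ 2 / 2)%:C%C :> C.
Proof.
by rewrite -(rmorph_nat (real_complex R) 2) -fmorphV -rmorphXn -rmorphM.
Qed.

Lemma ReB (x y : C) : complex.Re (x - y) = complex.Re x - complex.Re y.
Proof. by case: x y => [? ?] []. Qed.

Lemma real_complexP (x : R) : (x%:C%C : C) \is Num.real.
Proof. by apply/complex_realP; exists x. Qed.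

(** The measured eigenvalue of the shift approximates [- (mu - i nu)], whose real part is [- mu];
    the formula solves [mu = l0 + kap * l] for [l]. *)
Definition estimate n (kap : R) (y : 'I_n) : R :=
  (- complex.Re (spectral_diag (shift_mx C n) 0 y) - l0) / kap.

(** The unwanted eigenvector has weight at most [8 kap^2], which [mixture_bound] multiplies by 4;
    the other error term is Chebyshev's inequality for [phase_estimation]. *)
Lemma detection n (kap eps l : R) (mu nu : C) :
  (1 < n)%N -> 0 < kap <= 1 / 8 -> 0 < eps ->
  `|l| <= 1 -> mu = (encoded kap l)%:C%C ->
  nu = (Num.sqrt (1 - encoded kap l ^+ 2))%:C%C ->
  (1 - (32%:R * kap ^+ 2 + 60%:R / (n%:R * (kap * eps)) ^+ 2))%:C%C <=
  \sum_(y | `|l%:C%C - (estimate kap y)%:C%C| <= eps%:C%C)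
    `|(spectralmx (shift_mx C n) *m
       ((mu + nu) ^+ 2 / 2 *: window_vec n (- (mu - 'i * nu))
        + (mu - nu) ^+ 2 / 2 *: window_vec n (- (mu + 'i * nu)))) y 0| ^+ 2.
Proof.
move=> n1 /andP[kap0 kap8] eps0 l1.
have [] := @encoded_bounds kap l; rewrite ?(ltW kap0) //.
set m := encoded kap l; set v := Num.sqrt _ => v0 circ m0 rho muE nuE.
have circC : mu ^+ 2 + nu ^+ 2 = 1 by rewrite muE nuE -!rmorphXn -rmorphD circ.
have mur : mu \is Num.real by rewrite muE; exact: real_complexP.
have nur : nu \is Num.real by rewrite nuE; exact: real_complexP.
have norm1 (x : C) : x \is Num.real -> mu ^+ 2 + x ^+ 2 = 1 -> `|- (mu + 'i * x)| = 1.
  move=> xr cx; rewrite normrN; apply/eqP; rewrite -(@eqrXn2 _ 2) ?normr_ge0 ?ler01 //.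
  by rewrite expr1n normC2_rect // cx.
have z1 : `|- (mu - 'i * nu)| = 1 by rewrite -mulrN norm1 ?realN // sqrrN.
have z2 : `|- (mu + 'i * nu)| = 1 by exact: norm1.
have Pu := spectral_unitarymx (shift_mx C n).
rewrite mulmx_lin2.
set ke := (kap * eps)%:C%C.
have ke0 : 0 < ke by rewrite ltcR mulr_gt0.
have nC : (n%:R : C) = (n%:R : R)%:C%C by rewrite rmorph_nat.
have fE : (60%:R / (n%:R * (kap * eps)) ^+ 2)%:C%C =
    60%:R / n%:R ^+ 2 / ke ^+ 2 :> C.
  by rewrite exprMn invfM mulrA !rmorphM /= !fmorphV !rmorphXn /= rmorph_nat -nC.
have r1E : (mu + nu) ^+ 2 / 2 = ((m + v) ^+ 2 / 2)%:C%C.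
  by rewrite muE nuE -rmorphD half_sqr_real.
have halfD (x y : C) : (x + y) ^+ 2 / 2 + (x - y) ^+ 2 / 2 = x ^+ 2 + y ^+ 2.
  by field.
have rhoE : (mu - nu) ^+ 2 / 2 = ((m - v) ^+ 2 / 2)%:C%C.
  by rewrite muE nuE -rmorphB half_sqr_real.
have step : (1 - (32%:R * kap ^+ 2 + 60%:R / (n%:R * (kap * eps)) ^+ 2))%:C%C
    <= 1 - (4%:R * ((mu - nu) ^+ 2 / 2) + 60%:R / n%:R ^+ 2 / ke ^+ 2).
  rewrite rmorphB rmorph1 rmorphD /= fE lerD2l lerN2 lerD2r rhoE.
  by rewrite -(rmorph_nat (real_complex R)) -rmorphM lecR /=; lra.
apply: (le_trans step).
apply: mixture_bound.
- by rewrite rhoE lecR mulr_ge0 ?sqr_ge0 // invr_ge0 ler0n.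
- by rewrite halfD circC.
- by rewrite r1E rhoE lecR ler_pM2r ?invr_gt0 ?ltr0n // !expr2; nra.
- by rewrite r1E; exact: real_complexP.
- by rewrite cdot_unitary // window_vec_norm.
- by rewrite cdot_unitary // window_vec_norm.
rewrite ler_pdivlMr ?exprn_gt0 //.
apply: le_trans (phase_estimation n1 z1).
(* Chebyshev: the second moment is restricted to the outcomes with a bad estimate, for which the
   measured eigenvalue is at least [kap * eps] away. *)
rewrite mulr_suml [leRHS](bigID (fun y =>
  `|l%:C%C - (estimate kap y)%:C%C| <= eps%:C%C)) /=.
apply: ler_wpDl; first by apply: sumr_ge0 => y _; rewrite mulr_ge0 ?exprn_ge0.
apply: ler_sum => y far; rewrite mulrC ler_wpM2r ?exprn_ge0 //.
rewrite ler_sqr ?nnegrE ?normr_ge0 ?(ltW ke0) //.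
(* The distance between eigenvalues is at least that between their real parts, which is [kap] times
   the error of the estimate. *)
apply: le_trans (normc_ge_Re _).
move: far; rewrite -rmorphB normc_real lecR -ltNge lecR /estimate => far.
have ReE : complex.Re (- (mu - 'i * nu)) = - m.
  apply: (@complexI R); rewrite complexRe opprB addrC.
  have -> : (- m)%:C%C = - mu by rewrite muE rmorphN.
  by apply: Re_rect; rewrite ?rpredN.
rewrite ReB ReE [leLHS]mulrC -ler_pdivlMr //.
apply: le_trans (ltW far) _.
rewrite -{2}(gtr0_norm kap0) -normfV -normrM -normrN /m /encoded.
set w := complex.Re _; rewrite le_eqVlt; apply/orP; left; apply/eqP; congr (`|_|).
by field; rewrite gt_eqF.
Qed.

End Detection.

(** * The algorithm *)

Section Algorithm.
Variables (R : realType) (dI nw N tJ tW n : nat).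
Local Notation C := R[i].
Local Notation a := (3 * n)%N.
Local Notation D := (regdim dI nw N tJ tW a).
Local Notation nW := (2 ^ nw)%N.
Variables (VJin VJout : 'M[C]_(tJ, dI)) (VWin VWout : 'M[C]_(tW, nW)).
Hypotheses (VJinP : isometry_mx VJin) (VJoutP : isometry_mx VJout).
Hypotheses (VWinP : isometry_mx VWin) (VWoutP : isometry_mx VWout).
Hypotheses (dI0 : (0 < dI)%N) (tJ0 : (0 < tJ)%N) (tW0 : (0 < tW)%N).
Hypothesis n1 : (1 < n)%N.
Variable wt : 'I_3 -> R.
Hypotheses (wt0 : forall q, 0 <= wt q) (wt1 : \sum_q wt q = 1).

Local Notation t0 := (tensv (ket0 R tJ) (ket0 R tW)).
Local Notation i0 := (ket0 R dI).
Local Notation w0 := (ket0 R nW).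
Local Notation good := (@good R dI nw N tJ tW n wt).
Local Notation good_fam := (@good_fam R dI nw N tJ tW n wt).
Local Notation core := (core N n VJin VJout VWin VWout wt).
Local Notation win := (window_vec n (1 : C)).
Local Notation Four := (spectralmx (shift_mx C n)).

Definition ready : 'cV[C]_a := tensv (amp wt) win.

Definition prepare : 'M[C]_a :=
  swap_mx (fun _ : unit => ket0 R a) (fun _ => ready).

Definition algorithm : circuit R D :=
  [:: Free (on_work dI nw N tJ tW prepare)] ++ core ++
  [:: Free (on_work dI nw N tJ tW (1%:M *t Four))].

Lemma ket0_unitO : orthonormal_family (fun _ : unit => ket0 R a).
Proof. by move=> [] []; rewrite eqxx cdot_ket0 // muln_gt0 (ltnW n1). Qed.

Lemma ready_unitO : orthonormal_family (fun _ : unit => ready).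
Proof.
by move=> [] []; rewrite eqxx cdot_tensv amp_unit // window_vec_norm ?mulr1 ?normr1.
Qed.

(* The window vanishes at 0, which is why a reflection can prepare it. *)
Lemma ket0_ready (x y : unit) : cdot (ket0 R a) ready = 0.
Proof.
rewrite cdotE big1 // => i _; rewrite mxE.
have [i0|] := eqVneq (i : nat) 0%N; last by rewrite rmorph0 mul0r.
case: (mxtens_indexP i) i0 => q k /=; rewrite /ready tensvE.
move=> /eqP; rewrite addn_eq0 => /andP[_ /eqP k0].
by rewrite window_vec0 // !mulr0.
Qed.

Lemma prepareE : prepare *m ket0 R a = ready.
Proof. exact: (swap_mul ket0_unitO ket0_ready tt). Qed.

Lemma algorithm_valid : valid algorithm.
Proof.
have pu : on_work dI nw N tJ tW prepare \is unitarymx.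
  apply: on_work_unitary.
  exact: swap_unitary ket0_unitO ready_unitO ket0_ready.
have fu : on_work dI nw N tJ tW ((1%:M : 'M[C]_3) *t Four) \is unitarymx.
  apply/on_work_unitary/tens_unitary; first exact: unitarymx1.
  exact: spectral_unitarymx.
rewrite /algorithm valid_cat; apply/andP; split.
  by apply/andP; split; first exact: pu.
rewrite valid_cat; apply/andP; split; first exact: core_valid.
by apply/andP; split; first exact: fu.
Qed.

Lemma algorithm_nqueries : nqueries algorithm = (5 * n.-1 + 10)%N.
Proof.
have e : nqueries algorithm = nqueries (core ++
  [:: Free (on_work dI nw N tJ tW ((1%:M : 'M[C]_3) *t Four))]) by [].
by rewrite e nqueries_cat core_nqueries addn0.
Qed.

Variables (M : nat) (lab : 'I_M -> 'I_dI) (w : 'I_M -> 'I_nW) (b : 'I_M -> R).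
Variables (Cl : 'I_nW -> 'M[C]_N).
Variables (UC : 'M[C]_(nW * N)) (UB : 'M[C]_dI) (UT : 'M[C]_(tJ * tW)).
Hypothesis lab_inj : injective lab.
Hypotheses (b0 : forall j, 0 <= b j) (b1 : \sum_j b j = 1).
Hypothesis ClV : forall j, Cl (w j) *m Cl (w j) = 1%:M.
Hypothesis UCP : forall v phi,
  UC *m tensv (ket R v) phi = tensv (ket R v) (Cl v *m phi).
Hypotheses (UBu : UB \is unitarymx) (UTu : UT \is unitarymx).
Hypothesis UBP : UB *m i0 = \sum_j (Num.sqrt (b j))%:C%C *: ket R (lab j).
Hypothesis UTP : forall j, UT *m ((VJin *t VWin) *m tensv (ket R (lab j)) w0) =
  (VJout *t VWout) *m tensv (ket R (lab j)) (ket R (w j)).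

Local Notation run := (run UC UB UT).
Local Notation A := (\sum_j (b j)%:C%C *: Cl (w j)).

Lemma final_stateE psi :
  final_state UC UB UT algorithm psi =
  on_work dI nw N tJ tW (1%:M *t Four) *m
    run core (\sum_k win k 0 *: good k psi).
Proof.
have -> : final_state UC UB UT algorithm psi =
    run algorithm (st false i0 w0 psi t0 (ket0 R a)).
  rewrite runE /final_state /st; congr (foldl _ (tensv _ _) _).
  by apply/colP => i; rewrite !mxE -val_eqE andbT.
rewrite /algorithm run_cat run_free on_work_st prepareE run_nil run_cat.
rewrite run_free run_nil.
congr (_ *m run _ _).
by rewrite /ready {1}(ket_basis win) tensv_sumr (eq_bigr _ (fun k _ =>
  tensvZr _ _ _)) st_sumal.
Qed.

Lemma good_sum k (I : Type) (r : seq I) (F : I -> 'cV[C]_N) :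
  good k (\sum_(i <- r) F i) = \sum_(i <- r) good k (F i).
Proof.
rewrite /good (eq_bigr (fun i => 1 *: F i)); last by move=> i _; rewrite scale1r.
by rewrite st_sumphi; apply: eq_bigr => i _; rewrite scale1r.
Qed.

Variable nu : C -> C.
Let mu l : C := (wt ord0)%:C%C - (wt (Ordinal (isT : 2 < 3)%N))%:C%C
  + (wt (Ordinal (isT : 1 < 3)%N))%:C%C * l.

Definition outcome (m v : C) : 'cV[C]_n :=
  Four *m ((m + v) ^+ 2 / 2 *: window_vec n (- (m - 'i * v))
         + (m - v) ^+ 2 / 2 *: window_vec n (- (m + 'i * v))).

(** By linearity each eigencomponent of [psi] goes through [run_core] separately. The powers of the
    walk eigenvalues turn the window into [window_vec], and the change of basis before the
    measurement is moved to the other side of the inner product and back. *)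
Lemma final_coef psi y s : A \is hermsymmx ->
  (forall l, l \in eigvals A -> eigproj A l psi != 0 ->
     mu l ^+ 2 + nu l ^+ 2 = 1 /\ nu l != 0) ->
  cdot (good_fam (y, s)) (final_state UC UB UT algorithm psi) =
  \sum_(l <- eigvals A) outcome (mu l) (nu l) y 0 * eigproj A l psi s 0.
Proof.
move=> Ah munu; rewrite final_stateE cdot_adj on_work_adj.
have core_coef k k' l : l \in eigvals A ->
    cdot (good_fam (k', s)) (run core (good k (eigproj A l psi))) =
    (k' == k)%:R * (((mu l + nu l) ^+ 2 / 2 * (- (mu l - 'i * nu l)) ^+ k
      + (mu l - nu l) ^+ 2 / 2 * (- (mu l + 'i * nu l)) ^+ k)
      * eigproj A l psi s 0).
  (* A vanishing projection contributes 0 on both sides, so [munu] is called only for eigenvalues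
     that occur in [psi]. *)
  move=> lA; have [p0|p0] := eqVneq (eigproj A l psi) 0.
    have g0 : good k 0 = 0 by have := @good_sum k nat [::] (fun=> 0); rewrite !big_nil.
    by rewrite p0 g0 -(scale0r (0 : 'cV[C]_D)) runZ scale0r cdot0 mxE !mulr0.
  have [circ nu0] := munu l lA p0.
  by apply: (@run_core R dI nw N tJ tW n VJin VJout VWin VWout VJinP VJoutP
    VWinP VWoutP dI0 tJ0 tW0 wt wt0 wt1 M lab w b Cl UC UB UT) => //;
    exact: eigprojP.
have inner k' : cdot (good_fam (k', s)) (run core (\sum_k win k 0 *: good k psi)) =
    \sum_(l <- eigvals A)
      ((mu l + nu l) ^+ 2 / 2 *: window_vec n (- (mu l - 'i * nu l))
       + (mu l - nu l) ^+ 2 / 2 *: window_vec n (- (mu l + 'i * nu l))) k' 0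
      * eigproj A l psi s 0.
  rewrite run_sum cdot_sum (bigD1 k') //= [X in _ + X]big1 => [|k /negPf kk].
    rewrite addr0 runZ cdotZ -{1}(sum_eigproj psi Ah) good_sum run_sum cdot_sum.
    rewrite mulr_sumr [LHS]big_seq [RHS]big_seq; apply: eq_bigr => l lA.
    rewrite (core_coef _ _ _ lA).
    rewrite eqxx mul1r mulrA.
    congr (_ * _).
    rewrite [RHS]mxE [X in _ = X + _]mxE [X in _ = _ + X]mxE.
    have dist (x p q u v t t' : C) : t = x * u -> t' = x * v ->
        x * (p * u + q * v) = p * t + q * t' by move=> -> ->; ring.
    exact: dist (window_vec_phase _ _) (window_vec_phase _ _).
  rewrite runZ cdotZ -(sum_eigproj psi Ah) good_sum run_sum cdot_sum.
  rewrite [X in _ * X]big_seq big1 ?mulr0 // => l lA.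
  by rewrite (core_coef _ _ _ lA) eq_sym kk mul0r.
have adjE : on_work dI nw N tJ tW ((1%:M *t Four)^t*) *m good_fam (y, s) =
    \sum_k' (Four y k')^* *: good_fam (k', s).
  rewrite /good_fam /good on_work_st tens_adj tens_tensv trmx1 map_mx1 mul1mx.
  rewrite (ket_basis (Four^t* *m _)) tensv_sumr (eq_bigr _ (fun k _ =>
    tensvZr _ _ _)) st_sumal; apply: eq_bigr => k _; congr (_ *: _).
  by rewrite /ket -colE !mxE.
rewrite adjE cdot_suml.
rewrite (eq_bigr _ (fun k' _ => cdotZl _ _ _)) (eq_bigr _ (fun k' _ =>
  congr1 ( *%R _) (inner k'))).
rewrite (eq_bigr _ (fun k' _ => mulr_sumr _ _ _ _)) exchange_big /=.
apply: eq_bigr => l _; rewrite /outcome [(Four *m _) y 0]mxE mulr_suml.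
apply: eq_bigr => k' _.
by rewrite conjCK mulrA.
Qed.

End Algorithm.

(** * Choice of the constants *)

Section Constants.
Variables (R : realType) (eps delta : R).
Hypotheses (epsP : 0 < eps < expR (- 1)) (deltaP : 0 < delta < 1).

(** Chosen so that [32 * kappa ^+ 2 = delta / 2], half of the allowed failure. *)
Definition kappa : R := Num.sqrt delta / 8.

(** As [kappa ^+ 2 = delta / 64], the other half, [60 / (n kappa eps)^2 <= delta / 2], amounts to
    [7680 <= (n delta eps)^2], and 88 is the least integer whose square reaches 7680. *)
Definition grid : nat := (Num.truncn (88 / (delta * eps))).+1.

(** The solution of [w0 - w2 = 1 / sqrt 2], [w1 = kappa] and [w0 + w1 + w2 = 1]. *)
Definition weight (q : 'I_3) : R :=
  nth 0 [:: (1 - kappa + Num.sqrt (1 / 2)) / 2; kappa;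
           (1 - kappa - Num.sqrt (1 / 2)) / 2] q.

Lemma kappa_bounds : 0 < kappa <= 1 / 8.
Proof.
have /andP[d0 d1] := deltaP.
have s0 : 0 < Num.sqrt delta by rewrite sqrtr_gt0.
have s1 : Num.sqrt delta <= 1 by rewrite -sqrtr1 ler_sqrt ?ltW.
by rewrite /kappa; apply/andP; split; lra.
Qed.

Lemma weight_ge0 q : 0 <= weight q.
Proof.
have /andP[k0 k1] := kappa_bounds; have /andP[l0 l1] := l0_bounds R.
by case: q => [[|[|[]]]] //= ?; rewrite /weight /=; lra.
Qed.

Lemma weight_sum : \sum_q weight q = 1.
Proof. by rewrite 3!big_ord_recl big_ord0 /weight /=; field. Qed.

Lemma weight_encoded (l : R) :
  ((weight ord0)%:C%C - (weight (Ordinal (isT : 2 < 3)%N))%:C%C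
   + (weight (Ordinal (isT : 1 < 3)%N))%:C%C * l%:C%C)
  = (encoded kappa l)%:C%C :> R[i].
Proof.
rewrite -rmorphM -rmorphB -rmorphD /weight /encoded /=; congr (_%:C)%C.
by field.
Qed.

Lemma eps_bounds : 0 < eps < 1.
Proof.
have /andP[e0 e1] := epsP; rewrite e0 (lt_le_trans e1) //.
by rewrite -[leRHS]expR0 ler_expR lerN10.
Qed.

Lemma grid_bounds :
  88 <= grid%:R * (delta * eps) <= 89.
Proof.
have /andP[d0 d1] := deltaP; have /andP[e0 e1] := eps_bounds.
have de0 : 0 < delta * eps by rewrite mulr_gt0.
have de1 : delta * eps <= 1 by nra.
have x0 : 0 <= 88 / (delta * eps) by rewrite divr_ge0 ?ltW.
rewrite -ler_pdivrMr // /grid ltW ?truncnS_gt //= -natr1 mulrDl mul1r.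
have : (Num.truncn (88 / (delta * eps)))%:R * (delta * eps) <= 88.
  by rewrite -ler_pdivlMr // truncn_le.
lra.
Qed.

Lemma grid_gt1 : (1 < grid)%N.
Proof.
have /andP[d0 d1] := deltaP; have /andP[e0 e1] := eps_bounds.
have /andP[g _] := grid_bounds.
rewrite -(ltr_nat R); apply: lt_le_trans (_ : 88 <= _); first by rewrite ltr_nat.
apply: le_trans g _; rewrite ler_piMr ?ler0n //; nra.
Qed.

Lemma failure_bound :
  32 * kappa ^+ 2 + 60 / (grid%:R * (kappa * eps)) ^+ 2 <= delta.
Proof.
have /andP[d0 d1] := deltaP; have /andP[e0 e1] := eps_bounds.
have /andP[g _] := grid_bounds.
have k2 : kappa ^+ 2 = delta / 64.
  by rewrite /kappa exprMn sqr_sqrtr ?ltW // exprVn; field.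
have : 60 / (grid%:R * (kappa * eps)) ^+ 2 <= delta / 2.
  rewrite exprMn [(kappa * eps) ^+ 2]exprMn k2.
  have g2 : 88 ^+ 2 <= (grid%:R * (delta * eps)) ^+ 2.
    by rewrite ler_sqr ?nnegrE // (le_trans _ g).
  have p0 : 0 < grid%:R ^+ 2 * (delta / 64 * eps ^+ 2).
    by rewrite !mulr_gt0 ?exprn_gt0 ?invr_gt0 ?ltr0n.
  rewrite ler_pdivrMr //.
  have -> : delta / 2 * (grid%:R ^+ 2 * (delta / 64 * eps ^+ 2)) =
    (grid%:R * (delta * eps)) ^+ 2 / 128 by rewrite !exprMn; field.
  by lra.
by rewrite k2; lra.
Qed.

(** For [eps < 1 / e] the inner logarithm exceeds 1, so the denominator is positive, and
    [ln x < x]. *)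
Lemma log_ratio_ge1 : 1 <= ln (1 / eps) / ln (ln (1 / eps)).
Proof.
have /andP[e0 e1] := epsP.
have L1 : 1 < ln (1 / eps).
  by rewrite div1r lnV ?posrE // -ltrN2 opprK -(expRK (-1)) ltr_ln ?posrE ?expR_gt0.
have LL0 : 0 < ln (ln (1 / eps)) by rewrite ln_gt0.
rewrite div1r in L1 LL0 *; rewrite ler_pdivlMr // mul1r.
by apply/ltW/ln_sublinear; apply: lt_trans L1.
Qed.

(** With [n = grid] there are [5 n + 5] queries, and [(5 n + 5) delta eps] is at most [5 * 89 + 5],
    below 455. *)
Lemma query_bound : ((5 * grid.-1 + 10)%N)%:R <=
  455 * (1 / (delta * eps) * (ln (1 / eps) / ln (ln (1 / eps)))).
Proof.
have /andP[d0 d1] := deltaP; have /andP[e0 e1] := eps_bounds.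
have de0 : 0 < delta * eps by rewrite mulr_gt0.
have x0 : 0 <= 1 / (delta * eps) by rewrite divr_ge0 ?ltW.
apply: (@le_trans _ _ (455 * (1 / (delta * eps)))); last first.
  by rewrite ler_wpM2l // ler_peMr // log_ratio_ge1.
have /andP[_ g] := grid_bounds.
rewrite mulrA mulr1 ler_pdivlMr //.
have -> : (5 * grid.-1 + 10 = 5 * grid + 5)%N by rewrite /grid /=; lia.
rewrite natrD natrM mulrDl -mulrA.
by nra.
Qed.

End Constants.

(** * Correctness and query count of the algorithm *)

Lemma isometry_gt0 (R : realType) m n (V : 'M[R[i]]_(m, n)) :
  isometry_mx V -> (0 < n)%N -> (0 < m)%N.
Proof.
case: m V => // V VV; case: n V VV => // n V /matrixP/(_ 0 0).
by rewrite !mxE big_ord0 => /eqP; rewrite eq_sym oner_eq0.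
Qed.

Local Open Scope complex_scope.

Theorem theorem9 (R : realType) :
  exists2 K : R, 0 < K &
  forall (M dI nw N tJ tW : nat)
    (lab : 'I_M -> 'I_dI)
    (VJin VJout : 'M[R[i]]_(tJ, dI)) (VWin VWout : 'M[R[i]]_(tW, 2 ^ nw)),
    injective lab ->
    isometry_mx VJin -> isometry_mx VJout -> isometry_mx VWin -> isometry_mx VWout ->
  forall eps delta : R,
    0 < eps < expR (- 1) -> 0 < delta < 1 ->
  exists (a : nat) (c : circuit R (regdim dI nw N tJ tW a)) (est : 'I_a -> R),
    [/\ valid c,
        (nqueries c)%:R <=
          K * (1 / (delta * eps) * (ln (1 / eps) / ln (ln (1 / eps)))) &
        forall (b : 'I_M -> R) (w : 'I_M -> 'I_(2 ^ nw))
          (Cl : 'I_(2 ^ nw) -> 'M[R[i]]_N)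
          (UC : 'M[R[i]]_(2 ^ nw * N)) (UB : 'M[R[i]]_dI)
          (UT : 'M[R[i]]_(tJ * tW)),
          (forall j, 0 <= b j) -> \sum_j b j = 1 ->
          (forall j, Cl (w j) \is hermsymmx) ->
          (forall j, Cl (w j) \is unitarymx) ->
          UC \is unitarymx ->
          (forall v phi, UC *m tensv (ket R v) phi =
             tensv (ket R v) (Cl v *m phi)) ->
          UB \is unitarymx ->
          UB *m ket0 R dI =
            \sum_j (Num.sqrt (b j))%:C *: ket R (lab j) ->
          UT \is unitarymx ->
          (forall j, UT *m ((VJin *t VWin) *m
               tensv (ket R (lab j)) (ket0 R (2 ^ nw))) =
             (VJout *t VWout) *m tensv (ket R (lab j)) (ket R (w j))) ->
          forall psi : 'cV[R[i]]_N, unit_state psi ->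
          (1 - delta)%:C <=
            success_prob UC UB UT c (\sum_j (b j)%:C *: Cl (w j)) est eps psi].
Proof.
exists 455 => // M dI nw N tJ tW lab VJin VJout VWin VWout lab_inj VJinP VJoutP
  VWinP VWoutP eps delta epsP deltaP.
have qb := query_bound epsP deltaP.
(* With an empty index register there is no label, so [M = 0] and the weights [b] cannot sum to 1:
   the empty circuit will do. *)
have [dI0|dI0] := posnP dI.
  exists 0%N, [::], (fun=> 0); split=> //.
    by rewrite (le_trans _ qb).
  move=> b w Cl UC UB UT _ b1; exfalso.
  suff : (1 : R) == 0 by rewrite oner_eq0.
  rewrite -b1 big1 // => j _; case: (lab j) => i ilt.
  by exfalso; rewrite dI0 in ilt.
have tJ0 := isometry_gt0 VJinP dI0.
have tW0 : (0 < tW)%N by apply: (isometry_gt0 VWinP); rewrite expn_gt0.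
have n1 := grid_gt1 epsP deltaP.
set n := grid eps delta in n1 *.
have wt0 := weight_ge0 deltaP.
(* The work register holds the ancilla of dimension 3 and the grid of the phase estimation; the
   estimate is read from the grid alone. *)
exists (3 * n)%N, (algorithm N n VJin VJout VWin VWout (weight delta)),
  (fun x => estimate (kappa delta) (mxtens_unindex x).2).
split; first exact: algorithm_valid (weight_sum delta).
  by rewrite algorithm_nqueries.
move=> b w Cl UC UB UT b0 b1 Ch Cu _ UCP UBu UBP UTu UTP psi psi1.
have ClV j : Cl (w j) *m Cl (w j) = 1%:M.
  by rewrite -{1}(hermsym_adj (Ch j)) unitary_adj_mul.
set A := \sum_j _.
have Ah : A \is hermsymmx.
  apply/is_hermitianmxP; rewrite expr0 scale1r /A.
  rewrite (linear_sum (@trmx _ N N)) map_mx_sum; apply: eq_bigr => j _.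
  rewrite linearZ /= map_mxZ /= hermsym_adj //; congr (_ *: _).
  by apply/esym/CrealP; exact: real_complexP.
have [e0 e1] := andP (eps_bounds epsP).
pose mu (l : R[i]) : R := encoded (kappa delta) (complex.Re l).
pose nu (l : R[i]) : R[i] := (Num.sqrt (1 - mu l ^+ 2))%:C%C.
have lE l : l \in eigvals A -> l = (complex.Re l)%:C%C.
  by move=> /(eigvals_real Ah)/complex_realP[x ->].
have l1 l : l \in eigvals A -> eigproj A l psi != 0 -> `|complex.Re l| <= 1.
  move=> lA p0; rewrite -lecR -normc_real -lE // rmorph1.
  exact: (convex_unitary_eigenvalue b0 b1 Ch Cu (eigvals_real Ah lA) p0 (eigprojP _ _ _)).
have [k0 k8] := andP (kappa_bounds deltaP).
have munu l : l \in eigvals A -> eigproj A l psi != 0 ->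
    (mu l)%:C%C ^+ 2 + nu l ^+ 2 = 1 /\ nu l != 0.
  move=> lA p0; have [] := @encoded_bounds R (kappa delta) (complex.Re l).
  - by rewrite ltW.
  - exact: l1.
  rewrite -/(mu l) => v0 circ _ _; split; last first.
    by rewrite /nu (inj_eq (@complexI R)) gt_eqF.
  by rewrite /nu -!rmorphXn -rmorphD circ.
have muE l : l \in eigvals A -> (weight delta ord0)%:C%C
    - (weight delta (Ordinal (isT : 2 < 3)%N))%:C%C
    + (weight delta (Ordinal (isT : 1 < 3)%N))%:C%C * l = (mu l)%:C%C.
  by move=> lA; rewrite {1}(lE l lA) weight_encoded.
pose chi l := outcome n (mu l)%:C%C (nu l).
have coefs y s : cdot (good_fam dI nw tJ tW (weight delta) (y, s))
    (final_state UC UB UT (algorithm N n VJin VJout VWin VWout (weight delta)) psi)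
    = \sum_(l <- eigvals A) chi l y 0 * eigproj A l psi s 0.
  rewrite (@final_coef R dI nw N tJ tW n VJin VJout VWin VWout VJinP VJoutP VWinP
    VWoutP dI0 tJ0 tW0 n1 _ wt0 (weight_sum delta) M lab w b Cl UC UB UT lab_inj b0 b1
    ClV UCP UBu UTu UBP UTP nu psi y s Ah).
    by rewrite [LHS]big_seq [RHS]big_seq; apply: eq_bigr => l lA; rewrite muE.
  by move=> l lA p0; rewrite muE //; exact: munu.
have := @success_bound R dI nw N tJ tW n dI0 tJ0 tW0 _ wt0 (weight_sum delta) A _
  (estimate (kappa delta)) eps psi (fun=> erefl) Ah _ chi coefs.
apply: le_trans.
have psi1' : cdot psi psi = 1 by rewrite /cdot psi1 mxE.
(* The squared norms of the projections of [psi] sum to 1, so [1 - delta] is distributed over the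
   eigenvalues and compared term by term. *)
rewrite -[leLHS]mulr1 -psi1' -(sum_eigproj_norm psi Ah) mulr_sumr.
rewrite big_seq [leRHS]big_seq; apply: ler_sum => l lA; rewrite mulrC.
have [->|p0] := eqVneq (eigproj A l psi) 0; first by rewrite cdot0 !mul0r.
rewrite ler_wpM2l ?cdot_ge0 //.
have := @detection R n (kappa delta) eps (complex.Re l) (mu l)%:C%C (nu l) n1
  (kappa_bounds deltaP) e0 (l1 l lA p0) erefl erefl.
rewrite -(lE l lA); apply: le_trans.
by rewrite lecR lerD2l lerN2 failure_bound.
Qed.
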